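(* Let $0<p<1$, $0<r<1$ and $0<\lambda<\frac{r}{p+r}$. Consider a network with Bernoulli packet arrivals at rate $\lambda$ over the Gilbert-Elliott erasure channel $GE(p,r)$. Let $\bar\Delta_F$ and $\bar\Delta_L$ be the average age of information under the first-come-first-served (FCFS) policy and under the preemptive last-generated-first-served (pLGFS) policy, respectively, and let $D_i$ and $Y_i$ be the inter-delivery time and the preemption time of the $i$-th packet. Then $$\bar\Delta_F=\bar\Delta_L+\lambda\,\mathbb{E}[DY],$$ where $\mathbb{E}[DY]$ denotes the long-run per-packet average $\lim_{n\to\infty}\frac1n\sum_{i=1}^n D_iY_i$.
   Context: Time is slotted, $t=1,2,\dots$. Packets are generated (equivalently, arrive at the transmitter) at the beginning of a slot. At most one packet is transmitted per slot; a packet transmitted in slot $t$ and not erased is received at the end of slot $t$, i.e. at the beginning of slot $t+1$. A packet may be transmitted in the same slot in which it is generated. Channel $GE(p,r)$: the channel state is a two-state Markov chain on $\{G,B\}$ (one step per slot) with transition probability $p$ from $G$ to $B$ and $r$ from $B$ to $G$. A transmission in a slot with state $G$ always succeeds (erasure probability $0$), and in a slot with state $B$ always fails (erasure probability $1$). Bernoulli arrival at rate $\lambda$: in each slot a new packet arrives with probability $\lambda$ and no packet arrives with probability $1-\lambda$, independently over slots and independently of the channel. FCFS policy: the transmitter has an infinite buffer (initially empty) and serves packets in order of generation; a packet is transmitted, repeatedly until success, only after all earlier packets have been successfully delivered. pLGFS policy: the transmitter holds a single packet; the latest generated packet is transmitted repeatedly, slot after slot, until it is either successfully delivered or preempted (replaced)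 by the next arriving packet. Age of information (AoI): at the beginning of slot $t$, $\Delta_t=t-u_t$, where $u_t$ is the generation slot of the latest (most recently generated) packet received by the beginning of slot $t$. The average AoI is the long-run time average $\lim_{\tau\to\infty}\frac1\tau\sum_{t=1}^{\tau}\Delta_t$ (almost surely; the value assigned before the first delivery is irrelevant). Let $t_i$ be the generation slot of the $i$-th packet, and let $t_i'$ be its receiving time under the FCFS policy (if it is successfully transmitted in slot $s$, then $t_i'=s+1$). The inter-delivery time is $D_i=t_{i+1}'-t_i'$. Let $t_{w}$ be the largest slot in $[t_i,t_i')$ in which a packet is generated (so $t_w\ge t_i$). The preemption time is $Y_i=t_w-t_i\ge 0$. *)

(* Defs.v *)
From HB Require Import structures.
From mathcomp Require Import all_boot all_order all_algebra.
From mathcomp Require Import all_classical all_reals all_analysis.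
Set Implicit Arguments.
Unset Strict Implicit.
Unset Printing Implicit Defensive.
Import Order.TTheory GRing.Theory Num.Theory.
Import numFieldNormedType.Exports.
Local Open Scope classical_set_scope.
Local Open Scope ring_scope.

(** Slots are the natural numbers t >= 1; nothing below depends on the values
    at index 0.  On a sample path, [a t] means that a packet is generated in
    slot t, and [g t] that the channel is in the good state in slot t.  A packet
    is identified with its generation slot. *)

Section SamplePath.
Variables a g : nat -> bool.

(** Packets in the FCFS buffer that are available for transmission in slot t,
    oldest first; a packet generated in slot t is already included. *)
Fixpoint fcfs_queue (t : nat) : seq nat :=
  if t is s.+1 then
    let left := if g s then behead (fcfs_queue s) else fcfs_queue s in
    if a s.+1 then rcons left s.+1 else left
  else [::].

(** The packet successfully transmitted in slot t, if any. *)
Definition fcfs_delivered (t : nat) : option nat :=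
  if g t then ohead (fcfs_queue t) else None.

(** The single packet that pLGFS has available for transmission in slot t; a
    packet generated in slot t preempts the one held so far. *)
Fixpoint plgfs_held (t : nat) : option nat :=
  if t is s.+1 then
    if a s.+1 then Some s.+1
    else if g s then None else plgfs_held s
  else None.

Definition plgfs_delivered (t : nat) : option nat :=
  if g t then plgfs_held t else None.

(** [t] is the generation slot of the i-th packet, i >= 1. *)
Definition is_ith_arrival (i t : nat) : Prop :=
  [/\ (0 < t)%N, a t & (\sum_(1 <= s < t.+1) a s)%N = i].

(** [t_i]; the default value 0 is used only if there is no i-th packet. *)
Definition gen_slot (i : nat) : nat := xget 0%N [set t | is_ith_arrival i t].

(** [t_i']: a packet transmitted successfully in slot s is received at s + 1.
    The default is used only if the packet is never delivered. *)
Definition recv_slot (i : nat) : nat :=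
  (xget 0%N [set s | fcfs_delivered s = Some (gen_slot i)]).+1.

(** [t_w]: the largest slot of [t_i, t_i') in which a packet is generated. *)
Definition last_gen_slot (i : nat) : nat :=
  (\max_(gen_slot i <= s < recv_slot i | a s) s)%N.

End SamplePath.

(** [u_t], for a policy given by the packets it delivers in each slot: the most
    recent generation slot among the packets received by the beginning of slot t
    (0 before the first delivery). *)
Definition latest_received (delivered : nat -> option nat) (t : nat) : nat :=
  (\max_(1 <= s < t) odflt 0 (delivered s))%N.

Section Averages.
Variable R : realType.

Definition AoI (delivered : nat -> option nat) (t : nat) : R :=
  t%:R - (latest_received delivered t)%:R.

Definition average_AoI (delivered : nat -> option nat) (tau : nat) : R :=
  tau%:R^-1 * \sum_(1 <= t < tau.+1) AoI delivered t.

Definition inter_delivery (a g : nat -> bool) (i : nat) : R :=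
  (recv_slot a g i.+1)%:R - (recv_slot a g i)%:R.

Definition preemption_time (a g : nat -> bool) (i : nat) : R :=
  (last_gen_slot a g i)%:R - (gen_slot a i)%:R.

Definition average_DY (a g : nat -> bool) (n : nat) : R :=
  n%:R^-1 *
    \sum_(1 <= i < n.+1) inter_delivery a g i * preemption_time a g i.

(** Transition probabilities of GE(p, r); the good state is [true]. *)
Definition GE_trans (p r : R) (x y : bool) : R :=
  match x, y with
  | true, true => 1 - p
  | true, false => p
  | false, true => r
  | false, false => 1 - r
  end.

End Averages.

Section Model.
Context d (T : measurableType d) (R : realType) (P : probability T R).

(** The cylinder event "X_t = x_t for every t in s". *)
Definition cylinder (X : nat -> {RV P >-> bool}) (s : seq nat)
    (x : nat -> bool) : set T :=
  [set w | forall t, t \in s -> X t w = x t].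

Definition bernoulli_arrivals (arr : nat -> {RV P >-> bool}) (lambda : R) :
    Prop :=
  (forall t, (0 < t)%N -> P [set w | arr t w = true] = lambda%:E) /\
  (forall (s : seq nat) (x : nat -> bool), uniq s -> all (leq 1) s ->
     P (cylinder arr s x) = (\prod_(t <- s) P [set w | arr t w = x t])%E).

(** The Markov property with the transition probabilities of GE(p, r), with
    conditional probabilities cleared of denominators; the law of the initial
    state is arbitrary. *)
Definition GE_channel (chan : nat -> {RV P >-> bool}) (p r : R) : Prop :=
  forall (n : nat) (x : nat -> bool), (0 < n)%N ->
    P (cylinder chan (iota 1 n.+1) x) =
    (P (cylinder chan (iota 1 n) x) * (GE_trans p r (x n) (x n.+1))%:E)%E.

(** Independence of two processes, on the cylinder events that generate their
    sigma-algebras. *)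
Definition independent_processes (X Y : nat -> {RV P >-> bool}) : Prop :=
  forall (s s' : seq nat) (x y : nat -> bool),
    all (leq 1) s -> all (leq 1) s' ->
    P (cylinder X s x `&` cylinder Y s' y) =
    (P (cylinder X s x) * P (cylinder Y s' y))%E.

End Model.

(* Main.v *)
Require Import Defs.
From mathcomp Require Import all_boot all_order all_algebra.
From mathcomp Require Import all_classical all_reals all_analysis.
From mathcomp Require Import ring lra zify.
Set Implicit Arguments.
Unset Strict Implicit.
Unset Printing Implicit Defensive.
Import Order.TTheory GRing.Theory Num.Theory.
Import numFieldNormedType.Exports.
Local Open Scope classical_set_scope.
Local Open Scope ring_scope.

(** Sample-path identity: pLGFS has received the newest packet generated up to the
    last good slot, FCFS the packet just ahead of the backlog.  Between the
    receptions of the packets i and i+1 the two ages differ by Y_i in every slot: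
    if the backlog is nonempty, no good slot occurs before packet i+1 is transmitted, and if it is
    empty, Y_i = 0 and the ages agree.  So the ages summed up to the reception of
    packet n+1 differ by sum_(i <= n) D_i Y_i, and that reception time is
    asymptotically n / lambda.

    Almost sure convergence of the average ages: as functions of the history of
    arrivals and channel states, both ages depend only on a random window of
    recent slots, whose length has bounded fourth moments by a Chernoff bound for
    arrivals minus good slots.  Since the channel contracts at a Doeblin rate,
    the conditional expectation of the age k slots ahead is within O(1/k) of a
    constant in L2.  Telescoping the age into k martingale difference arrays gives
    E (S_n - n c)^2 = O(k^2 n + n^2 / k^2); Chebyshev with n = j^8 and k of order
    j^2, Borel-Cantelli and the monotonicity of S_n conclude. *)

(** * Conditional expectations along finite histories *)

(** None of the three limits is computed. The two average ages are only shown to converge; the limit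
    of [average_DY] is then forced by the identity along the reception times and by the packet rate.
    The backlog is controlled through the age itself: it is at most the FCFS age, and the terms of a
    sequence with convergent averages are o(n).

    The obstacle is that the FCFS age is not a function of a finite-state chain. It is treated as a
    function of the whole slot history, whose kernel is that of a finite chain with a Doeblin atom,
    and truncated to a window of m recent slots. Truncation errs only where the memory exceeds m;
    there the fourth moment of the memory buys the factor m^-2 in the squared error. Since r / (p +
    r) is the long-run fraction of good slots, the bound on lambda makes long windows with at least
    as many arrivals as good slots exponentially rare. *)

Lemma sqrD_weighted (R : realFieldType) (m a b : R) : 0 < m ->
  (a + b) ^+ 2 <= (1 + m^-1) * a ^+ 2 + (m + 1) * b ^+ 2.
Proof.
move=> m0; have -> : (1 + m^-1) * a ^+ 2 + (m + 1) * b ^+ 2 =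
    (a + b) ^+ 2 + m^-1 * (a - m * b) ^+ 2 by field; rewrite lt0r_neq0.
by rewrite lerDl mulr_ge0 ?sqr_ge0 // invr_ge0 ltW.
Qed.

(** Cauchy-Schwarz by induction: with the number of summands so far as weight, [sqrD_weighted] is an
    equality for equal summands, so the sharp factor k survives each step. *)
Lemma sqr_sum_le (R : realFieldType) (k : nat) (F : nat -> R) :
  (\sum_(j < k) F j) ^+ 2 <= k%:R * \sum_(j < k) F j ^+ 2.
Proof.
case: k => [|k]; first by rewrite !big_ord0 mul0r expr0n.
elim: k => [|k IH]; first by rewrite !big_ord1 mul1r.
rewrite [in leLHS]big_ord_recr [in leRHS]big_ord_recr /=.
set A := (\sum_(j < _) F j) in IH *; set B := (\sum_(j < _) F j ^+ 2) in IH *.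
set f := F _; have m0 : 0 < (k.+1)%:R :> R by rewrite ltr0n.
rewrite -[k.+2%:R]natr1; move: (k.+1)%:R m0 IH => m m0 IH.
rewrite mulrDr; apply: le_trans (sqrD_weighted A f m0) _; rewrite lerD2r.
have -> : (m + 1) * B = (1 + m^-1) * (m * B) by field; rewrite lt0r_neq0.
by rewrite ler_pM2l // addr_gt0 // invr_gt0.
Qed.

(* A history lists the states of the past slots, the most recent slot first, and
   [kap h y] is the conditional probability of y as the next state.  Then
   [expect n F h] is the expectation of F at the history reached n slots after h. *)
Section History.
Variables (S : finType) (R : realFieldType).
Variable kap : seq S -> S -> R.
Hypothesis kap_ge0 : forall h y, 0 <= kap h y.
Hypothesis kap_sum : forall h, \sum_y kap h y = 1.

Implicit Types (F G : seq S -> R) (h : seq S).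

Definition step F h : R := \sum_y kap h y * F (y :: h).

Definition expect n F h : R := iter n step F h.
Arguments expect : simpl never.

Lemma eq_step F G h : (forall y, F (y :: h) = G (y :: h)) -> step F h = step G h.
Proof. by move=> FG; apply: eq_bigr => y _; rewrite FG. Qed.

Lemma le_step F G h : (forall y, F (y :: h) <= G (y :: h)) -> step F h <= step G h.
Proof. by move=> FG; apply: ler_sum => y _; rewrite ler_wpM2l. Qed.

Lemma step_cst c h : step (fun=> c) h = c.
Proof. by rewrite /step -big_distrl /= kap_sum mul1r. Qed.

Lemma stepD F G h : step (fun h => F h + G h) h = step F h + step G h.
Proof. by rewrite /step -big_split; apply: eq_bigr => y _; rewrite mulrDr. Qed.

Lemma stepZ c F h : step (fun h => c * F h) h = c * step F h.
Proof. by rewrite /step mulr_sumr; apply: eq_bigr => y _; rewrite mulrCA. Qed.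

Lemma step_sqr F h : step F h ^+ 2 <= step (fun h => F h ^+ 2) h.
Proof.
set m := step F h.
have : 0 <= step (fun h' => (F h' - m) ^+ 2) h.
  by rewrite -[leLHS](step_cst 0 h); apply: le_step => y; apply: sqr_ge0.
rewrite (@eq_step _ (fun h' => F h' ^+ 2 + ((- 2 * m) * F h' + m ^+ 2))); last first.
  by move=> y; ring.
by rewrite stepD stepD stepZ step_cst -/m; nra.
Qed.

Lemma expectS n F h : expect n.+1 F h = step (expect n F) h.
Proof. by []. Qed.

Lemma expectSr n F h : expect n.+1 F h = expect n (step F) h.
Proof. by rewrite /expect iterSr. Qed.

Lemma expect_expect m n F h : expect m (expect n F) h = expect (m + n) F h.
Proof. by rewrite /expect iterD. Qed.

Lemma eq_expect_size n F G h :
  (forall h', size h' = (n + size h)%N -> F h' = G h') ->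
  expect n F h = expect n G h.
Proof.
elim: n h => [|n IH] h FG; first exact: FG.
rewrite !expectS; apply: eq_step => y; apply: IH => h' /= sh; apply: FG; by rewrite sh addnS.
Qed.

Lemma eq_expect n F G h : (forall h, F h = G h) -> expect n F h = expect n G h.
Proof. by move=> FG; apply: eq_expect_size => h' _. Qed.

Lemma le_expect n F G h : (forall h, F h <= G h) -> expect n F h <= expect n G h.
Proof.
by move=> FG; elim: n h => [|n IH] h //; rewrite !expectS; apply: le_step => y; apply: IH.
Qed.

Lemma expect_cst n c h : expect n (fun=> c) h = c.
Proof.
elim: n h => [|n IH] h //; rewrite expectS (@eq_step _ (fun=> c)) ?step_cst //.
Qed.

Lemma expectD n F G h :
  expect n (fun h => F h + G h) h = expect n F h + expect n G h.
Proof.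
elim: n h => [|n IH] h //; rewrite !expectS -stepD.
by apply: eq_step => y; apply: IH.
Qed.

Lemma expectZ n c F h : expect n (fun h => c * F h) h = c * expect n F h.
Proof.
elim: n h => [|n IH] h //; rewrite !expectS -stepZ.
by apply: eq_step => y; apply: IH.
Qed.

Lemma expect_sum n k (F : nat -> seq S -> R) h :
  expect n (fun h => \sum_(j < k) F j h) h = \sum_(j < k) expect n (F j) h.
Proof.
elim: k => [|k IH].
  by rewrite big_ord0 -[RHS](expect_cst n 0 h); apply: eq_expect => h'; rewrite big_ord0.
rewrite big_ord_recr /= -IH -expectD.
by apply: eq_expect => h'; rewrite big_ord_recr.
Qed.

Lemma expect_ge0 n F h : (forall h, 0 <= F h) -> 0 <= expect n F h.
Proof. by move=> F0; rewrite -[leLHS](expect_cst n 0 h); apply: le_expect. Qed.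

Lemma expect_sqr n F h : expect n F h ^+ 2 <= expect n (fun h => F h ^+ 2) h.
Proof.
elim: n h => [|n IH] h //; rewrite !expectS.
by apply: (le_trans (step_sqr _ _)); apply: le_step => y; apply: IH.
Qed.

(** The empty history contributes a term too, hence the n + 1 terms at time n in all later
    bounds. *)
Fixpoint sums F h : R :=
  if h is _ :: h' then sums F h' + F h else F h.

Definition mdiff F h : R := if h is _ :: h' then F h - step F h' else F h.

(* The increments [mdiff F] are orthogonal. *)
Lemma sums_mdiff_sqr F C n :
  (forall t, expect t (fun h => F h ^+ 2) [::] <= C) ->
  expect n (fun h => sums (mdiff F) h ^+ 2) [::] <= n.+1%:R * C.
Proof.
move=> FC; elim: n => [|n IH]; first by rewrite mul1r; apply: (FC 0%N).
rewrite expectSr.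
apply: (@le_trans _ _ (expect n (fun h => sums (mdiff F) h ^+ 2 +
    step (fun h => F h ^+ 2) h) [::])).
  apply: le_expect => h; set T := sums _ h; set m := step F h.
  rewrite (@eq_step _ (fun h' => F h' ^+ 2 + (2 * (T - m) * F h' + (T - m) ^+ 2))); last first.
    by move=> y /=; rewrite -/T -/m; ring.
  rewrite stepD stepD stepZ step_cst -/m; nra.
rewrite expectD -expectSr -[n.+2%:R]natr1 mulrDl mul1r.
by apply: lerD.
Qed.

(** No cancellation is used: this is Minkowski's bound, meant for the remainder [expect k F], whose
    second moment is already small. *)
Lemma sums_sqr F C n :
  (forall t, expect t (fun h => F h ^+ 2) [::] <= C) ->
  expect n (fun h => sums F h ^+ 2) [::] <= n.+1%:R ^+ 2 * C.
Proof.
move=> FC; elim: n => [|n IH]; first by rewrite expr1n mul1r; apply: (FC 0%N).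
have m0 : 0 < (n.+1)%:R :> R by rewrite ltr0n.
rewrite expectSr; move: IH; rewrite -[n.+2%:R]natr1; move: n.+1%:R m0 => m m0 IH.
apply: (@le_trans _ _ (expect n (fun h => (1 + m^-1) * sums F h ^+ 2 +
    (m + 1) * step (fun h => F h ^+ 2) h) [::])).
  apply: le_expect => h; rewrite -stepZ -[X in _ <= X + _](step_cst _ h) -stepD.
  apply: le_step => y /=; set T := sums _ h; set f := F _.
  exact: sqrD_weighted.
rewrite expectD !expectZ -expectSr.
have -> : (m + 1) ^+ 2 * C = (1 + m^-1) * (m ^+ 2 * C) + (m + 1) * C.
  by field; rewrite ?lt0r_neq0 //.
apply: lerD; rewrite ler_pM2l // addr_gt0 // ?invr_gt0 //.
Qed.

(** Iterates the split of F h into its deviation from [step F] at the parent history and that value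
    itself. Summing over the history shifts the second part by one slot, which leaves one boundary
    term per round. *)
Lemma sums_decomp F k h :
  sums F h = \sum_(j < k) sums (mdiff (expect j F)) h + sums (expect k F) h
             - \sum_(j < k) expect j.+1 F h.
Proof.
have aux G : sums G h = sums (mdiff G) h + sums (step G) h - step G h.
  by elim: h => [|y h IH] /=; rewrite ?IH; ring.
elim: k => [|k IH]; first by rewrite !big_ord0 add0r subr0.
rewrite !big_ord_recr /= IH (aux (expect k F)).
rewrite -[sums (expect k.+1 F) h]/(sums (step (expect k F)) h) expectS.
by ring.
Qed.

(** Each of the k + 1 martingale sums has second moment at most (n + 1) C, and Cauchy-Schwarz over
    them costs another k + 1. The boundary terms give (k + 1)^2 C, which is absorbed because n + 1
    >= 1; this doubles the 3 of the three-term split to 6. *)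
Lemma sums_l2 F C k n :
  (forall t, expect t (fun h => F h ^+ 2) [::] <= C) ->
  (forall t, expect t (fun h => expect k.+1 F h ^+ 2) [::] <= C / k.+1%:R ^+ 2) ->
  expect n (fun h => sums F h ^+ 2) [::] <=
    6 * C * (k.+1%:R ^+ 2 * n.+1%:R + n.+1%:R ^+ 2 / k.+1%:R ^+ 2).
Proof.
move=> FC FkC; set q : R := k.+1%:R; set m : R := n.+1%:R.
have C0 : 0 <= C by apply: le_trans (FC 0%N); apply: expect_ge0 => h; apply: sqr_ge0.
have m1 : 1 <= m by rewrite ler1n.
have FjC j t : expect t (fun h => expect j F h ^+ 2) [::] <= C.
  apply: le_trans (FC (t + j)%N); rewrite -expect_expect.
  by apply: le_expect => h; apply: expect_sqr.
apply: (@le_trans _ _ (expect n (fun h =>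
   3 * q * (\sum_(j < k.+1) sums (mdiff (expect j F)) h ^+ 2) +
   (3 * sums (expect k.+1 F) h ^+ 2 +
   3 * q * \sum_(j < k.+1) expect j.+1 F h ^+ 2)) [::])).
  apply: le_expect => h; rewrite (sums_decomp F k.+1).
  have := sqr_sum_le k.+1 (fun j => sums (mdiff (expect j F)) h).
  have := sqr_sum_le k.+1 (fun j => expect j.+1 F h).
  rewrite -/q -!mulrA; set a := \sum_(j < _) sums _ _; set b := \sum_(j < _) expect _ _ _.
  set a2 := q * _; set b2 := q * _; set c := sums _ _ => hb ha.
  have := sqr_ge0 (a - c); have := sqr_ge0 (a + b); have := sqr_ge0 (c + b); nra.
rewrite expectD expectD !expectZ.
rewrite (expect_sum n k.+1 (fun j h => sums (mdiff (expect j F)) h ^+ 2)).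
rewrite (expect_sum n k.+1 (fun j h => expect j.+1 F h ^+ 2)).
have h1 : \sum_(j < k.+1) expect n (fun h => sums (mdiff (expect j F)) h ^+ 2) [::]
    <= q * (m * C).
  rewrite /q -[in leRHS](card_ord k.+1) mulr_natl -sumr_const.
  by apply: ler_sum => j _; apply: sums_mdiff_sqr => t; apply: FjC.
have h2 : \sum_(j < k.+1) expect n (fun h => expect j.+1 F h ^+ 2) [::] <= q * C.
  rewrite /q -[in leRHS](card_ord k.+1) mulr_natl -sumr_const.
  by apply: ler_sum => j _; apply: FjC.
have h3 : expect n (fun h => sums (expect k.+1 F) h ^+ 2) [::] <= m ^+ 2 * (C / q ^+ 2).
  exact: sums_sqr.
have q0 : 0 <= 3 * q by rewrite mulr_ge0 // ler0n.
apply: (le_trans (lerD (ler_wpM2l q0 h1) (lerD (ler_wpM2l _ h3) (ler_wpM2l q0 h2)))) => //.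
have h4 : 3 * q * (q * C) <= 3 * q * (q * (m * C)).
  rewrite !ler_wpM2l ?ler0n //; by rewrite ler_peMl.
have h5 : 0 <= m ^+ 2 * (C / q ^+ 2).
  by rewrite mulr_ge0 ?sqr_ge0 // divr_ge0 // sqr_ge0.
have -> : 6 * C * (q ^+ 2 * m + m ^+ 2 / q ^+ 2) =
  6 * (q * (q * (m * C))) + 6 * (m ^+ 2 * (C / q ^+ 2)) by ring.
by move: (m ^+ 2 * _) h5 h4 => w; clearbody q m => *; lra.
Qed.

End History.

(** * Mixing of functions with a random finite memory *)

Lemma sum_geometric_le (R : realFieldType) (q : R) (n : nat) : 0 <= q < 1 ->
  \sum_(i < n) q ^+ i <= (1 - q)^-1.
Proof.
move=> /andP[q0 q1]; rewrite -[leRHS]mul1r ler_pdivlMr ?subr_gt0 // mulrC.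
have -> : (1 - q) * \sum_(i < n) q ^+ i = 1 - q ^+ n.
  by apply: (can_inj opprK); rewrite -mulNr !opprB subrX1.
by rewrite gerBl exprn_ge0.
Qed.

Lemma bernoulli_inequality (R : realFieldType) (y : R) (j : nat) : 0 <= y <= 1 ->
  1 - j%:R * y <= (1 - y) ^+ j.
Proof.
move=> /andP[y0 y1]; elim: j => [|j IH]; first by rewrite mul0r subr0 expr0.
rewrite exprS; apply: le_trans (ler_wpM2l _ IH); last by rewrite subr_ge0.
have j0 : 0 <= j%:R :> R by rewrite ler0n.
rewrite -[j.+1%:R]natr1; move: j%:R j0 => a a0; nra.
Qed.

(** Stands in for a (j+1)-st root, which an ordered field need not contain: q' = 1 - (1 - q) / (j +
    1) works by Bernoulli's inequality. *)
Lemma root_lt1 (R : realFieldType) (q : R) (j : nat) : 0 <= q < 1 ->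
  exists2 q', 0 <= q' < 1 & q <= q' ^+ j.+1.
Proof.
move=> /andP[q0 q1]; pose y := (1 - q) / j.+1%:R.
have jP : 0 < j.+1%:R :> R by rewrite ltr0n.
have y0 : 0 < y by rewrite divr_gt0 // subr_gt0.
have y1 : y <= 1.
  by rewrite ler_pdivrMr // mul1r (@le_trans _ _ 1) ?ler1n // gerBl.
exists (1 - y); first by rewrite subr_ge0 y1 gtrBl y0.
apply: le_trans (bernoulli_inequality _ _); last by rewrite ltW.
by rewrite /y mulrC divfK ?gt_eqF // opprB addrC subrK.
Qed.

(** The powers q'^i decrease, so (n + 1) q'^n is at most the sum of q'^i over i <= n. Raising this
    to the power j + 1 handles the polynomial factor. *)
Lemma poly_geometric_bounded (R : realFieldType) (q : R) (j : nat) : 0 <= q < 1 ->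
  exists C, forall n : nat, n.+1%:R ^+ j * q ^+ n <= C.
Proof.
move=> q01; case: j => [|j].
  case/andP: q01 => q0 q1.
  by exists 1 => n; rewrite mul1r exprn_ile1 // ltW.
have [q' q'01 qq'] := root_lt1 j q01; case/andP: (q'01) => q'0 q'1.
exists ((1 - q')^-1 ^+ j.+1) => n; case/andP: q01 => q0 q1.
apply: (@le_trans _ _ ((n.+1%:R * q' ^+ n) ^+ j.+1)).
  rewrite exprMn ler_wpM2l ?exprn_ge0 // -exprM mulnC exprM.
  by rewrite lerXn2r // nnegrE // exprn_ge0.
rewrite lerXn2r ?nnegrE ?mulr_ge0 ?exprn_ge0 ?invr_ge0 ?subr_ge0 ?(ltW q'1) //.
apply: le_trans (sum_geometric_le n.+1 q'01).
rewrite -[X in X%:R](card_ord n.+1) mulr_natl -sumr_const.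
apply: ler_sum => i _; have iN : (i <= n)%N by rewrite -ltnS.
by rewrite -[in leLHS](subnK iN) exprD ler_piMl ?exprn_ge0 // exprn_ile1 // ltW.
Qed.

Lemma poly_geometric_summable (R : realFieldType) (q : R) (j : nat) : 0 <= q < 1 ->
  exists C, forall n : nat, \sum_(i < n) i.+1%:R ^+ j * q ^+ i <= C.
Proof.
move=> q01; have [q' q'01 qq'] := root_lt1 1 q01.
have [C hC] := poly_geometric_bounded j q'01.
case/andP: (q'01) (q01) => q'0 _ /andP[q0 _].
have C0 : 0 <= C by apply: le_trans (hC 0%N); rewrite mulr_ge0 ?exprn_ge0.
exists (C * (1 - q')^-1) => n.
apply: (@le_trans _ _ (\sum_(i < n) C * q' ^+ i)).
  apply: ler_sum => i _.
  apply: (@le_trans _ _ (i.+1%:R ^+ j * q' ^+ i * q' ^+ i)).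
    rewrite -mulrA -expr2 -exprM mulnC exprM ler_wpM2l ?exprn_ge0 //.
    by rewrite lerXn2r // nnegrE // exprn_ge0.
  by rewrite ler_wpM2r // exprn_ge0.
by rewrite -mulr_sumr ler_wpM2l // sum_geometric_le.
Qed.

Section Memory.
Variables (S : finType) (R : realFieldType).
Variable kap : seq S -> S -> R.
Hypothesis kap_ge0 : forall h y, 0 <= kap h y.
Hypothesis kap_sum : forall h, \sum_y kap h y = 1.
Implicit Types (F G : seq S -> R) (h : seq S).

Local Notation step := (step kap).
Local Notation expect := (expect kap).

(** * Chernoff bounds for bad windows of recent slots *)

Section Chernoff.
Variables (psi : S -> R) (v : seq S -> R) (rho V : R) (b : seq S -> bool).
Hypothesis psi_ge0 : forall y, 0 <= psi y.
Hypothesis v_bound : forall h, 1 <= v h <= V.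
Hypothesis rho01 : 0 <= rho < 1.
Hypothesis v_step : forall h, \sum_y kap h y * (psi y * v (y :: h)) <= rho * v h.
Hypothesis b_psi : forall s, b s -> 1 <= \prod_(y <- s) psi y.

(** By [v_step], v is a supersolution with eigenvalue rho for the kernel tilted by [psi], so the
    tilted mass of m slots decays like rho^m although the slots are dependent. *)
Lemma expect_weight m h :
  expect m (fun h' => (\prod_(y <- take m h') psi y) * v h') h <= rho ^+ m * v h.
Proof.
elim: m h => [|m IH] h.
  by rewrite /expect /= take0 big_nil.
rewrite expectSr; apply: (@le_trans _ _ (rho * (rho ^+ m * v h))); last by rewrite exprS mulrA.
apply: le_trans (ler_wpM2l _ (IH h)); last by case/andP: rho01.
rewrite -expectZ; apply: le_expect => // h'.
have w0 : 0 <= \prod_(y <- take m h') psi y by rewrite prodr_ge0.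
apply: le_trans (_ : (\prod_(y <- take m h') psi y) * (rho * v h') <= _); last by rewrite mulrCA.
apply: le_trans (ler_wpM2l w0 (v_step h')); rewrite mulr_sumr.
apply: ler_sum => y _ /=; rewrite big_cons.
by rewrite le_eqVlt; apply/orP; left; apply/eqP; ring.
Qed.

Lemma expect_take_tail m t : (m <= t)%N ->
  expect t (fun h => (b (take m h))%:R) [::] <= rho ^+ m * V.
Proof.
move=> mt; rewrite -(subnK mt) -expect_expect.
rewrite -[leRHS](expect_cst kap_sum (t - m) _ [::]); apply: le_expect => // h.
apply: (@le_trans _ _ (rho ^+ m * v h)); last first.
  by case/andP: rho01 => r0 _; rewrite ler_wpM2l ?exprn_ge0 //; case/andP: (v_bound h).
apply: le_trans (expect_weight m h); apply: le_expect => // h'.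
have w0 : 0 <= \prod_(y <- take m h') psi y by rewrite prodr_ge0.
have /andP[v1 _] := v_bound h'.
case e: (b _); last by rewrite mulr_ge0 // (le_trans _ v1).
by have := b_psi e; rewrite /=; nra.
Qed.

(* The length of the longest bad window of most recent slots (0 if there is none). *)
Definition last_bad h : nat := (\max_(m < (size h).+1 | b (take m h)) m)%N.

Lemma last_bad_ge h m : (m <= size h)%N -> b (take m h) -> (m <= last_bad h)%N.
Proof.
move=> mh bm; have mh' : (m < (size h).+1)%N by [].
exact: (@leq_bigmax_cond _ (fun m : 'I_(size h).+1 => b (take m h))
  (fun m => m : nat) (Ordinal mh')).
Qed.

Lemma last_bad_moment j : exists C, forall t,
  expect t (fun h => (last_bad h)%:R ^+ j.+1) [::] <= C.
Proof.
have [C hC] := poly_geometric_summable j.+1 rho01.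
have V1 : 1 <= V by have /andP[v1 vV] := v_bound [::]; apply: le_trans vV.
exists (C * V) => t.
apply: (@le_trans _ _ (expect t (fun h => \sum_(m < t.+1) m%:R ^+ j.+1 * (b (take m h))%:R) [::])).
  pose lhs h : R := (last_bad h)%:R ^+ j.+1.
  pose rhs h : R := \sum_(m < t.+1) m%:R ^+ j.+1 * (b (take m h))%:R.
  (* From the empty history [expect t] sees only histories of length t. On longer ones [last_bad]
     could exceed the range m <= t of the sum, so the left side is set to 0 there. *)
  pose lhs' h := if size h == t then lhs h else 0.
  rewrite -/lhs -/rhs (_ : expect t lhs [::] = expect t lhs' [::]); last first.
    by apply: eq_expect_size => h /=; rewrite addn0 /lhs' => ->; rewrite eqxx.
  have rhs0 h : 0 <= rhs h by apply: sumr_ge0 => m _; rewrite mulr_ge0 ?exprn_ge0.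
  apply: le_expect => // h; rewrite /lhs'; case: eqP => // st; rewrite /lhs.
  have [->|/eqP N0] := eqVneq (last_bad h) 0%N; first by rewrite expr0n.
  have [m bm ->] : exists2 m : 'I_(size h).+1, b (take m h) & last_bad h = m.
    have [bs|bs] := pickP (fun m : 'I_(size h).+1 => b (take m h)).
      move=> bbs; rewrite /last_bad (bigop.bigmax_eq_arg bs bbs).
      by case: arg_maxnP => // m bm _; exists m.
    by case: N0; rewrite /last_bad big_pred0.
  move: m bm; rewrite st => m bm.
  rewrite /rhs (bigD1 m) //= bm mulr1 lerDl; apply: sumr_ge0 => i _.
  by rewrite mulr_ge0 ?exprn_ge0.
rewrite (expect_sum kap_sum t t.+1 (fun m h => m%:R ^+ j.+1 * (b (take m h))%:R)).
apply: (@le_trans _ _ (\sum_(m < t.+1) (m.+1%:R ^+ j.+1 * rho ^+ m) * V)).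
  apply: ler_sum => m _; rewrite expectZ -mulrA.
  apply: ler_pM; rewrite ?exprn_ge0 //.
  - by apply: expect_ge0.
  - by rewrite lerXn2r ?nnegrE // ler_nat.
  - by apply: expect_take_tail; rewrite -ltnS.
by rewrite -mulr_suml ler_wpM2r // (le_trans ler01).
Qed.

End Chernoff.

Section FiniteMemory.
Variables (X : seq S -> R) (L : seq S -> nat) (C : R).
Hypothesis X_ge0 : forall h, 0 <= X h.
Hypothesis X_size : forall h, X h <= (size h).+1%:R.
Hypothesis L_gt0 : forall h, (0 < L h)%N.
Hypothesis X_take : forall h M, (L h <= M)%N -> X (take M h) = X h.
Hypothesis L_moment : forall t, expect t (fun h => (L h)%:R ^+ 4) [::] <= C.

Let XL h : X h <= 2 * (L h)%:R.
Proof.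
rewrite -(X_take (leqnn (L h))); apply: (le_trans (X_size _)).
rewrite -natrM ler_nat size_take_min; have := L_gt0 h; lia.
Qed.

Lemma memory_sqr_bounded t : expect t (fun h => X h ^+ 2) [::] <= 4 * C.
Proof.
apply: (@le_trans _ _ (expect t (fun h => 4 * (L h)%:R ^+ 4) [::])); last first.
  by rewrite expectZ ler_wpM2l.
apply: le_expect => // h; have := XL h; have := X_ge0 h.
have : 1 <= (L h)%:R :> R by rewrite ler1n.
move: (X h) (L h)%:R => a l l1 a0 al.
have : a ^+ 2 <= 4 * l ^+ 2 by nra.
have : 1 <= l ^+ 2 by nra.
move=> ? /le_trans; apply; rewrite ler_wpM2l // (_ : 4 = 2 * 2)%N // exprM; nra.
Qed.

(** The difference vanishes unless L > M + 1, and then it is at most 2 L, so L^2 / (M + 1)^2 >= 1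
    can be inserted. This is what calls for fourth moments of L. *)
Let X_trunc M h : (X h - X (take M.+1 h)) ^+ 2 <= 4 / M.+1%:R ^+ 2 * (L h)%:R ^+ 4.
Proof.
have m0 : 0 < M.+1%:R :> R by rewrite ltr0n.
have [LM|ML] := leqP (L h) M.+1.
  rewrite X_take // subrr expr0n /= mulr_ge0 ?exprn_ge0 // divr_ge0 ?exprn_ge0 //.
have h1 : X (take M.+1 h) <= 2 * (L h)%:R.
  apply: (le_trans (X_size _)); rewrite -natrM ler_nat size_take_min; lia.
have mL : M.+1%:R <= (L h)%:R :> R by rewrite ler_nat ltnW.
rewrite mulrAC ler_pdivlMr ?exprn_gt0 //.
have := XL h; have := X_ge0 h; have := X_ge0 (take M.+1 h).
move: h1 m0 mL; move: (X h) (X _) (L h)%:R M.+1%:R => a b l m bl m0 ml b0 a0 al.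
have h2 : (a - b) ^+ 2 <= 4 * l ^+ 2 by nra.
have h3 : m ^+ 2 <= l ^+ 2 by nra.
have -> : 4 * l ^+ 4 = (4 * l ^+ 2) * l ^+ 2 by ring.
by rewrite ler_pM ?sqr_ge0.
Qed.

(** * Loss of memory of the initial slot *)

Section Doeblin.
Hypothesis kap_markov : forall x h y, kap (x :: h) y = kap [:: x] y.
Variables (y0 : S) (delta : R).
Hypothesis delta01 : 0 < delta < 1.
Hypothesis kap_delta : forall x, delta <= kap [:: x] y0.

(** After n slots the window of length n has left x and h behind, and the kernel sees only x. The
    induction keeps the slots already drawn in s, so that n + [size s] is constant. *)
Lemma expect_window F n x h :
  expect n (fun h' => F (take n h')) (x :: h) =
  expect n (fun h' => F (take n h')) [:: x].
Proof.
suff aux s : expect n (fun h' => F (take (n + size s) h')) (s ++ x :: h) =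
             expect n (fun h' => F (take (n + size s) h')) (s ++ [:: x]).
  by have := aux [::]; rewrite addn0.
elim: n s => [|n IH] s; first by rewrite /expect /= !take_size_cat.
rewrite !expectS; apply: eq_bigr => y _; congr (_ * _).
  by case: s => [|z s] /=; rewrite kap_markov // [RHS]kap_markov.
by have := IH (y :: s); rewrite /= addnS.
Qed.

(** Each slot shrinks the radius around a centre by 1 - delta. The centre itself moves to (1 -
    delta) phi + delta g(y0), so only its existence is stated. *)
Lemma expect_contract g B n : (forall x h, g (x :: h) = g [:: x]) ->
  (exists phi, forall x, `|g [:: x] - phi| <= B) ->
  exists phi, forall x h, `|expect n g (x :: h) - phi| <= (1 - delta) ^+ n * B.
Proof.
case/andP: delta01 => d0 d1 ghead; elim: n g B ghead => [|n IH] g B ghead [phi hphi].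
  by exists phi => x h; rewrite mul1r /expect /= ghead.
have stephead x h : step g (x :: h) = step g [:: x].
  by apply: eq_bigr => y _; rewrite kap_markov !(ghead y).
have [|psi hpsi] := IH (step g) ((1 - delta) * B) stephead.
  exists ((1 - delta) * phi + delta * g [:: y0]) => x.
  (* Doeblin splitting: what remains of the kernel after removing the common atom
     of mass delta at y0. *)
  pose w y := kap [:: x] y - delta * (y == y0)%:R.
  have w0 y : 0 <= w y.
    by rewrite /w; case: eqP => [->|_]; rewrite ?mulr1 ?mulr0 ?subr0 ?subr_ge0.
  have dsum (f : S -> R) : \sum_y delta * (y == y0)%:R * f y = delta * f y0.
    rewrite (bigD1 y0) //= eqxx mulr1 big1 ?addr0 // => y /negbTE ->.
    by rewrite mulr0 mul0r.
  have sumw : \sum_y w y = 1 - delta.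
    rewrite /w sumrB kap_sum; congr (_ - _).
    by rewrite -[RHS]mulr1 -(dsum (fun=> 1)); apply: eq_bigr => y _; rewrite mulr1.
  have -> : step g [:: x] - ((1 - delta) * phi + delta * g [:: y0]) =
            \sum_y w y * (g [:: y] - phi).
    have -> : step g [:: x] = \sum_y w y * g [:: y] + delta * g [:: y0].
      rewrite -(dsum (fun y => g [:: y])) -big_split /=.
      by apply: eq_bigr => y _; rewrite -mulrDl subrK ghead.
    have sumphi : \sum_y w y * phi = (1 - delta) * phi by rewrite -mulr_suml sumw.
    under [RHS]eq_bigr do rewrite mulrBr.
    by rewrite sumrB sumphi opprD addrA addrAC addrK.
  apply: (le_trans (ler_norm_sum _ _ _)); rewrite -sumw mulr_suml.
  by apply: ler_sum => y _; rewrite normrM ger0_norm // ler_wpM2l.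
exists psi => x h; rewrite expectSr.
by apply: (le_trans (hpsi x h)); rewrite exprS mulrA [_ * (1 - delta)]mulrC.
Qed.

Lemma step_near F phi B h :
  (forall x h, `|F (x :: h) - phi| <= B) -> `|step F h - phi| <= B.
Proof.
move=> FB; rewrite -[X in _ - X](step_cst kap_sum phi h) /step -sumrB.
apply: (le_trans (ler_norm_sum _ _ _)).
rewrite -[leRHS](step_cst kap_sum B h) /step; apply: ler_sum => y _.
by rewrite -mulrBr normrM ger0_norm // ler_wpM2l.
Qed.

(** With m = M + 1, the horizon 2m + 1 consists of m slots that fill the truncation window, m slots
    that contract, and one slot that makes the history nonempty, since the contraction holds only
    from a nonempty history. The truncated function is at most m + 1, which the geometric factor
    beats. The centre still depends on M. *)
Lemma memory_mixing : exists C', forall M, exists phi, forall t,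
  expect t (fun h => (expect M.+1.*2.+1 X h - phi) ^+ 2) [::] <= C' / M.+1%:R ^+ 2.
Proof.
case/andP: (delta01) => d0 d1.
have q01 : 0 <= 1 - delta < 1 by rewrite subr_ge0 ltW //= gtrBl.
have [C1 hC1] := poly_geometric_bounded 2 q01.
exists (8 * C + 2 * (C1 ^+ 2 * 4)) => M; set m := M.+1.
pose g := expect m (fun h => X (take m h)).
have [||phi hphi] := @expect_contract g m.+1%:R m.
- by move=> x h; apply: (expect_window X).
- exists 0 => x; rewrite subr0 ger0_norm; last by apply: expect_ge0.
  rewrite -[leRHS](expect_cst kap_sum m _ [:: x]); apply: le_expect => // h.
  by apply: (le_trans (X_size _)); rewrite ler_nat size_take_min; lia.
exists phi => t.
have near h : `|expect m.*2.+1 (fun h => X (take m h)) h - phi| <=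
    (1 - delta) ^+ m * m.+1%:R.
  by rewrite expectS; apply: step_near => x h'; rewrite -addnn -expect_expect.
have m0 : 0 < m%:R :> R by rewrite ltr0n.
have nearB : ((1 - delta) ^+ m * m.+1%:R) ^+ 2 <= C1 ^+ 2 * 4 / m%:R ^+ 2.
  rewrite ler_pdivlMr ?exprn_gt0 // -exprMn.
  have h1 := hC1 m.
  have h2 : m%:R <= m.+1%:R :> R by rewrite ler_nat.
  have h3 : 0 <= (1 - delta) ^+ m by rewrite exprn_ge0 // subr_ge0 ltW.
  have h4 : (1 - delta) ^+ m * m.+1%:R * m%:R <= C1.
    apply: le_trans h1; rewrite mulrC mulrA expr2 mulrAC [leLHS]mulrC mulrC.
    rewrite [leLHS]mulrAC; nra.
  have h5 : 0 <= (1 - delta) ^+ m * m.+1%:R * m%:R by rewrite !mulr_ge0.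
  move: (_ * m%:R) h4 h5 => z; nra.
apply: (@le_trans _ _ (expect t (fun h =>
   2 * expect m.*2.+1 (fun h => (X h - X (take m h)) ^+ 2) h +
   2 * (C1 ^+ 2 * 4 / m%:R ^+ 2)) [::])).
  apply: le_expect => // h.
  set Y := (fun h => X (take m h)) in near *.
  have := expect_sqr kap_ge0 kap_sum m.*2.+1 (fun h => X h + -1 * Y h) h.
  rewrite expectD expectZ mulN1r => e1.
  have {}e1 : (expect m.*2.+1 X h - expect m.*2.+1 Y h) ^+ 2 <=
      expect m.*2.+1 (fun h => (X h - X (take m h)) ^+ 2) h.
    apply: (le_trans e1); rewrite le_eqVlt; apply/orP; left; apply/eqP.
    by apply: eq_expect => h'; rewrite mulN1r.
  have e2 : (expect m.*2.+1 Y h - phi) ^+ 2 <= C1 ^+ 2 * 4 / m%:R ^+ 2.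
    apply: le_trans nearB; rewrite -real_normK ?num_real //.
    by rewrite lerXn2r ?nnegrE // mulr_ge0 // exprn_ge0 // subr_ge0 ltW.
  have sq (a b z u : R) : (a - b) ^+ 2 <= z -> (b - phi) ^+ 2 <= u ->
      (a - phi) ^+ 2 <= 2 * z + 2 * u.
    by have := sqr_ge0 (a - b - (b - phi)); nra.
  exact: sq e1 e2.
rewrite expectD expectZ expect_cst // expect_expect [in leRHS]mulrDl.
apply: lerD; last by rewrite !mulrA.
apply: (@le_trans _ _ (2 * (4 / m%:R ^+ 2 * C))); last first.
  by rewrite le_eqVlt; apply/orP; left; apply/eqP; ring.
rewrite ler_wpM2l //.
apply: (@le_trans _ _ (expect (t + m.*2.+1) (fun h => 4 / m%:R ^+ 2 * (L h)%:R ^+ 4) [::])).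
  by apply: le_expect => // h; apply: X_trunc.
by rewrite expectZ ler_wpM2l // divr_ge0 // exprn_ge0.
Qed.

End Doeblin.
End FiniteMemory.
End Memory.

(** * Strong law of large numbers *)

Lemma sum_inv_sqr_le (R : realFieldType) (n : nat) :
  \sum_(i < n) (i.+1%:R ^+ 2)^-1 <= 2 :> R.
Proof.
case: n => [|n]; first by rewrite big_ord0.
apply: (@le_trans _ _ (2 - n.+1%:R^-1)); last by rewrite gerBl invr_ge0.
elim: n => [|n IH]; first by rewrite big_ord1 expr1n invr1; lra.
rewrite big_ord_recr /= -[n.+2%:R]natr1.
have m0 : 0 < n.+1%:R :> R by rewrite ltr0n.
move: n.+1%:R m0 IH => m m0 IH; apply: (le_trans (lerD IH (lexx _))).
have -> : 2 - m^-1 + ((m + 1) ^+ 2)^-1 = 2 - (m + 1)^-1 - (m * (m + 1) ^+ 2)^-1.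
  by field; rewrite !lt0r_neq0 // addr_gt0.
by rewrite gerBl invr_ge0 mulr_ge0 ?exprn_ge0 // ?addr_ge0 // ltW.
Qed.

Lemma between_eighth_powers (J n : nat) : (J ^ 8 <= n)%N ->
  exists2 j, (J <= j)%N & (j ^ 8 <= n < j.+1 ^ 8)%N.
Proof.
elim: n => [|n IH].
  by rewrite leqn0 expn_eq0 andbT => /eqP ->; exists 0%N.
rewrite leq_eqVlt => /orP[/eqP <-|]; first by (exists J; rewrite ?leqnn ?ltn_exp2r /=).
rewrite ltnS => /IH[j Jj /andP[jn nj]].
have [nj'|jn'] := ltnP n.+1 (j.+1 ^ 8); first by (exists j; rewrite ?nj' ?leqW).
exists j.+1; first exact: leqW.
by rewrite jn' /= (leq_ltn_trans nj) // ltn_exp2r.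
Qed.

(** 255 = 2^8 - 1 is the sum of the lower binomial coefficients, each lower power of j being at most
    j^7. *)
Lemma eighth_power_growth (R : realFieldType) (j : nat) : (0 < j)%N ->
  (j.+1 ^ 8)%:R <= (1 + 255 / j%:R) * (j ^ 8)%:R :> R.
Proof.
move=> j0; have y0 : 0 < j%:R :> R by rewrite ltr0n.
have y1 : 1 <= j%:R :> R by rewrite ler1n.
rewrite !natrX -[j.+1%:R]natr1; move: j%:R y0 y1 => x x0 x1.
have -> : (1 + 255 / x) * x ^+ 8 = x ^+ 8 + 255 * x ^+ 7 by field; rewrite lt0r_neq0.
have p (i k : nat) : (i <= k)%N -> x ^+ i <= x ^+ k by move=> ik; rewrite ler_weXn2l.
have -> : (x + 1) ^+ 8 = x ^+ 8 + 8 * x ^+ 7 + 28 * x ^+ 6 + 56 * x ^+ 5 +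
   70 * x ^+ 4 + 56 * x ^+ 3 + 28 * x ^+ 2 + 8 * x ^+ 1 + x ^+ 0 by ring.
have := p 6%N 7%N isT; have := p 5%N 7%N isT; have := p 4%N 7%N isT.
have := p 3%N 7%N isT; have := p 2%N 7%N isT; have := p 1%N 7%N isT.
have := p 0%N 7%N isT; lra.
Qed.

(** To be read with a = j^8, b = (j + 1)^8, m = n + 1, y = 1/j, z = 1/(j + 1), and u a value of a
    nondecreasing sum between ul and uu. As b exceeds a by a relative O(y), the squeeze costs
    another O(y). *)
Lemma sandwich_bound (R : realFieldType) (a b m c u ul uu y z : R) :
  0 <= a -> a + 1 <= m -> m <= b -> b <= (1 + 255 * y) * a -> 0 <= c -> 0 <= u ->
  ul <= u <= uu -> 0 <= z <= y -> y <= 1 ->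
  `|ul - (a + 1) * c| <= (a + 1) * y -> `|uu - (b + 1) * c| <= (b + 1) * z ->
  `|u / m - c| <= (256 * c + 257) * y.
Proof.
move=> a0 am mb bay c0 u0 /andP[ulu uuu] /andP[z0 zy] y1.
rewrite !ler_distl => /andP[hl _] /andP[_ hu].
have m0 : 0 < m by lra.
have y0 : 0 <= y by apply: le_trans zy.
have b1 : b + 1 <= (1 + 255 * y) * m.
  have : (1 + 255 * y) * (a + 1) <= (1 + 255 * y) * m by rewrite ler_wpM2l //; lra.
  by nra.
apply/andP; split.
  (* If c is below the error term the lower bound is nonpositive and follows from u >= 0; otherwise
     its positivity allows multiplication of inequalities. *)
  rewrite ler_pdivlMr //; have [Kc|cK] := lerP c ((256 * c + 257) * y).
    by apply: le_trans u0; apply: mulr_le0_ge0; rewrite ?subr_le0 // ltW.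
  set w := c - _; have w0 : 0 < w by rewrite subr_gt0.
  have h1 : m * w <= (1 + 255 * y) * (a + 1) * w by rewrite ler_pM2r //; nra.
  have h2 : (1 + 255 * y) * w <= c - y.
    have yy : 0 <= y * y by rewrite mulr_ge0.
    have yc : 0 <= y * c by rewrite mulr_ge0.
    have yyc : 0 <= y * y * c by rewrite mulr_ge0.
    by rewrite /w; nra.
  have h3 : (a + 1) * ((1 + 255 * y) * w) <= (a + 1) * (c - y).
    by rewrite ler_wpM2l // addr_ge0.
  by rewrite mulrC; lra.
rewrite ler_pdivrMr //.
have h1 : (b + 1) * (c + z) <= (1 + 255 * y) * m * (c + y).
  by rewrite ler_pM ?addr_ge0 ?lerD2l //; lra.
have h2 : (1 + 255 * y) * (c + y) <= c + (256 * c + 257) * y.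
  have : 0 <= y * c by rewrite mulr_ge0.
  have : y * y <= y by rewrite ler_piMl.
  by nra.
have h3 : m * ((1 + 255 * y) * (c + y)) <= m * (c + (256 * c + 257) * y).
  by rewrite ler_pM2l.
by lra.
Qed.

Lemma cvg_of_eighth_powers (R : realType) (s : nat -> R) (c : R) :
  0 <= c -> (forall n, 0 <= s n) -> {homo s : m n / (m <= n)%N >-> m <= n} ->
  (\forall j \near \oo,
     `|s (j ^ 8)%N - (j ^ 8).+1%:R * c| <= (j ^ 8).+1%:R / j%:R) ->
  s n / n.+1%:R @[n --> \oo] --> c.
Proof.
move=> c0 s0 smono [J _ sJ]; apply/cvgrPdistC_le => e e0.
pose K := 256 * c + 257.
have K0 : 0 < K by rewrite /K; lra.
pose j0 := (maxn J.+1 (Num.trunc (K / e)).+1).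
exists (j0 ^ 8)%N => // n /= /between_eighth_powers[j j0j /andP[jn nj]].
move: j0j; rewrite /j0 geq_max => /andP[/[dup] /ltnW Jj Jj1 tj].
have j1 : (0 < j)%N by apply: leq_ltn_trans Jj1.
have x0 : 0 < j%:R :> R by rewrite ltr0n.
have Kj : K / j%:R <= e.
  rewrite ler_pdivrMr // mulrC -ler_pdivrMr //.
  apply: ltW; apply: (lt_le_trans (truncnS_gt _)); rewrite ler_nat.
  exact: tj.
apply: le_trans Kj; move: x0.
have hl := sJ j Jj; have hu := sJ j.+1 (leqW Jj).
have := eighth_power_growth R j1.
have := smono _ _ jn; have := smono _ _ (ltnW nj).
have hj1 : j%:R^-1 >= j.+1%:R^-1 :> R by rewrite lef_pV2 ?posrE ?ltr0n // ler_nat.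
move: hl hu hj1; rewrite -![_.+1%:R / _]/(_ * _).
set a : R := (j ^ 8)%:R; set b : R := (j.+1 ^ 8)%:R; set m : R := n.+1%:R.
have am : a + 1 <= m by rewrite /a /m natr1 ler_nat.
have mb : m <= b by rewrite ler_nat.
have a0 : 0 <= a by rewrite ler0n.
rewrite -![(_ ^ 8).+1%:R]natr1 -/a -/b.
have y0 : 0 <= j.+1%:R^-1 :> R by rewrite invr_ge0.
have y1 : j%:R^-1 <= 1 :> R by rewrite invf_le1 ?ltr0n // ler1n.
move=> hl hu hj1 h1 h2 h3 _.
apply: (@sandwich_bound _ a b m c (s n) (s (j ^ 8)%N) (s (j.+1 ^ 8)%N) _ j.+1%:R^-1) => //.
  by rewrite h1 h2.
by rewrite y0.
Qed.

Fixpoint hist (S : Type) (x : nat -> S) (n : nat) : seq S :=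
  if n is m.+1 then x m.+1 :: hist x m else [::].

Lemma size_hist (S : Type) (x : nat -> S) n : size (hist x n) = n.
Proof. by elim: n => //= n ->. Qed.

Lemma sums_hist (S : finType) (R : realFieldType) (F : seq S -> R) x n :
  sums F (hist x n) = \sum_(t < n.+1) F (hist x t).
Proof.
by elim: n => [|n IH]; rewrite ?big_ord1 // big_ord_recr /= -IH.
Qed.

(** Exponents are balanced here: for deviations n / j, both k^2 n and n^2 / k^2 contribute O(j^-2),
    which is summable. The constant is 60 = 6 (9 + 1), with 9 from k <= 3 j^2. *)
Lemma chebyshev_rate (R : realFieldType) (C j k n : R) : 0 <= C -> 0 < j -> 0 < n ->
  2 * j ^+ 2 <= k -> k <= 3 * j ^+ 2 -> j ^+ 8 <= n ->
  (j / n) ^+ 2 * (6 * C * (k ^+ 2 * n + n ^+ 2 / k ^+ 2)) <= 60 * C / j ^+ 2.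
Proof.
move=> C0 j0 n0 jk kj jn; have j0' := ltW j0.
have k0 : 0 < k by apply: lt_le_trans jk; rewrite mulr_gt0 ?exprn_gt0.
have -> : (j / n) ^+ 2 * (6 * C * (k ^+ 2 * n + n ^+ 2 / k ^+ 2)) =
    6 * C * (j ^+ 2 * (k ^+ 2 / n) + j ^+ 2 / k ^+ 2).
  by field; rewrite !lt0r_neq0.
have k1 : k ^+ 2 <= 9 * j ^+ 4.
  have -> : 9 * j ^+ 4 = (3 * j ^+ 2) ^+ 2 by ring.
  by rewrite lerXn2r ?nnegrE // ltW // (lt_le_trans k0 kj).
have k2 : 4 * j ^+ 4 <= k ^+ 2.
  have -> : 4 * j ^+ 4 = (2 * j ^+ 2) ^+ 2 by ring.
  by rewrite lerXn2r ?nnegrE // ltW // mulr_gt0 // exprn_gt0.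
have h1 : j ^+ 2 * (k ^+ 2 / n) <= 9 / j ^+ 2.
  rewrite ler_pdivlMr ?exprn_gt0 // mulrA mulrAC ler_pdivrMr //.
  have -> : j ^+ 2 * k ^+ 2 * j ^+ 2 = j ^+ 4 * k ^+ 2 by ring.
  apply: (@le_trans _ _ (j ^+ 4 * (9 * j ^+ 4))); first by rewrite ler_wpM2l ?exprn_ge0.
  have -> : j ^+ 4 * (9 * j ^+ 4) = 9 * j ^+ 8 by ring.
  by rewrite ler_wpM2l.
have h2 : j ^+ 2 / k ^+ 2 <= 1 / j ^+ 2.
  rewrite ler_pdivlMr ?exprn_gt0 // mulrAC ler_pdivrMr ?exprn_gt0 // mul1r.
  apply: le_trans k2; have -> : j ^+ 2 * j ^+ 2 = j ^+ 4 by ring.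
  by rewrite ler_peMl ?exprn_ge0 // ltW // ltr1n.
have -> : 60 * C / j ^+ 2 = 6 * C * (9 / j ^+ 2 + 1 / j ^+ 2) by field; rewrite !lt0r_neq0.
by rewrite ler_wpM2l ?mulr_ge0 // lerD.
Qed.

(** * From expectations along histories to almost sure convergence *)

Section StrongLaw.
Context d (T : measurableType d) (R : realType) (P : probability T R).
Variables (S : finType) (xi : nat -> T -> S) (kap : seq S -> S -> R).
Hypothesis kap_ge0 : forall h y, 0 <= kap h y.
Hypothesis kap_sum : forall h, \sum_y kap h y = 1.
Local Notation H n w := (hist (fun t => xi t w) n).
Hypothesis xi_meas : forall h, measurable [set w | H (size h) w = h].
Hypothesis xi_law : forall h y,
  P [set w | H (size h).+1 w = y :: h] =
  (P [set w | H (size h) w = h] * (kap h y)%:E)%E.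

(** Fixing the initial history h lets the law of B be proved by induction on n, splitting on the
    next slot; the product form also covers histories of probability zero. *)
Let slice (B : pred (seq S)) h n := [set w | H (size h) w = h /\ B (H (size h + n) w)].

Let slice0 B h : slice B h 0 = if B h then [set w | H (size h) w = h] else set0.
Proof.
rewrite /slice addn0; case: ifP => Bh.
  by apply/seteqP; split=> [w []//|w /= e]; split=> //; rewrite e.
by apply/seteqP; split=> [w [e]|//]; rewrite e Bh.
Qed.

Let sliceS B h n : slice B h n.+1 = \bigcup_(y in [set: S]) slice B (y :: h) n.
Proof.
rewrite /slice; apply/seteqP; split=> [w [e Bw]|w [y _ [[_ e] Bw]]].
  exists (xi (size h).+1 w) => //; split; first by rewrite /= e.
  by move: Bw; rewrite addnS.
by split=> //; move: Bw; rewrite addnS.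
Qed.

Let slice_meas B h n : measurable (slice B h n).
Proof.
elim: n h => [|n IH] h.
  by rewrite slice0; case: ifP => _; [apply: xi_meas|apply: measurable0].
rewrite sliceS; apply: fin_bigcup_measurable => [|y _]; last exact: IH.
exact: finite_finset.
Qed.

Let slice_law B h n :
  P (slice B h n) =
  (P [set w | H (size h) w = h] * (expect kap n (fun h => (B h)%:R) h)%:E)%E.
Proof.
elim: n h => [|n IH] h.
  by rewrite slice0 /expect /=; case: ifP => _; rewrite ?mule1 ?mule0 ?measure0.
rewrite sliceS measure_fin_bigcup; first last.
- by move=> y _; apply: slice_meas.
- move=> y z _ _ [w [[/= [e _] _] [[e' _] _]]].
  by rewrite -e -e'.
- exact: finite_finset.
rewrite (fsbigE (index_enum S)) ?index_enum_uniq //; last first.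
  by move=> y _; rewrite mem_index_enum.
under eq_bigl do rewrite in_setT.
rewrite (eq_bigr (fun y => P [set w | H (size h) w = h] * (kap h y)%:E *
    (expect kap n (fun h => (B h)%:R) (y :: h))%:E)%E); last first.
  by move=> y _; apply: (etrans (IH (y :: h))); rewrite [X in (X * _)%E]xi_law.
have : P [set w | H (size h) w = h] \is a fin_num by apply: fin_num_measure.
move/fineK <-; rewrite expectS /step -EFinM mulr_sumr sumEFin.
by congr (_%:E); apply: eq_bigr => y _; rewrite mulrA.
Qed.

Lemma hist_event_measurable (B : pred (seq S)) n : measurable [set w | B (H n w)].
Proof.
rewrite (_ : [set w | _] = slice B [::] n); first exact: slice_meas.
by apply/seteqP; split=> [w /= Bw|w []//]; split.
Qed.

Lemma prob_hist (B : pred (seq S)) n :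
  P [set w | B (H n w)] = (expect kap n (fun h => (B h)%:R) [::])%:E.
Proof.
have := slice_law B [::] n.
have -> : slice B [::] n = [set w | B (H n w)].
  by apply/seteqP; split=> [w []//|w /= Bw]; split.
have -> : [set w | H (size (Nil S)) w = [::]] = [set: T].
  by apply/seteqP; split.
by rewrite probability_setT mul1e.
Qed.

Lemma strong_law (X : seq S -> R) (c C : R) :
  0 <= c -> (forall h, 0 <= X h) ->
  (forall t, expect kap t (fun h => (X h - c) ^+ 2) [::] <= C) ->
  (forall M t, expect kap t (fun h =>
      expect kap M.+1.*2.+1 (fun h => X h - c) h ^+ 2) [::] <=
      C / M.+1.*2.+1%:R ^+ 2) ->
  {ae P, forall w, sums X (H n w) / n.+1%:R @[n --> \oo] --> c}.
Proof.
move=> c0 X0 XC XkC.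
have C0 : 0 <= C.
  by apply: le_trans (XC 0%N); apply: expect_ge0 => // h; apply: sqr_ge0.
pose nn i := (i.+1 ^ 8)%N.
pose bad i h := (nn i).+1%:R / i.+1%:R < `|sums (fun h => X h - c) h|.
pose E i := [set w | bad i (H (nn i) w)].
have PE i : (P (E i) <= (60 * C * (i.+1%:R ^+ 2)^-1)%:E)%E.
  rewrite /E prob_hist lee_fin.
  have j0 : 0 < i.+1%:R :> R by rewrite ltr0n.
  have n0 : 0 < (nn i).+1%:R :> R by rewrite ltr0n.
  apply: (@le_trans _ _ (expect kap (nn i) (fun h =>
     (i.+1%:R / (nn i).+1%:R) ^+ 2 * sums (fun h => X h - c) h ^+ 2) [::])).
    apply: le_expect => // h; case e: (bad i h); last by rewrite mulr_ge0 // sqr_ge0.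
    rewrite -exprMn -real_normK ?num_real // exprn_ege1 // normrM ger0_norm ?divr_ge0 //.
    move: e; rewrite /bad ltr_pdivrMr // mulrAC ler_pdivlMr // mul1r => /ltW.
    by rewrite mulrC.
  rewrite expectZ.
  (* The decay hypothesis is available only at horizons 2 (M + 1) + 1; this M gives k = 2 j^2 + 1
     with j = i + 1, between 2 j^2 and 3 j^2. *)
  pose M := (i.+1 ^ 2).-1.
  have EM : M.+1 = (i.+1 ^ 2)%N by rewrite prednK // expn_gt0.
  have h1 := sums_l2 kap_ge0 kap_sum (nn i) XC (XkC M).
  have r0 : 0 <= (i.+1%:R / (nn i).+1%:R) ^+ 2 :> R by apply: sqr_ge0.
  apply: (le_trans (ler_wpM2l r0 h1)); apply: chebyshev_rate => //.
  - by rewrite EM -natrX -natrM ler_nat -muln2; lia.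
  - have i1 : (0 < i.+1 ^ 2)%N by rewrite expn_gt0.
    by rewrite EM -natrX -natrM ler_nat -muln2; lia.
  - by rewrite -natrX ler_nat.
have mE i : measurable (E i) by apply: hist_event_measurable.
have E0 : P (lim_sup_set E) = 0%E.
  apply: lim_sup_set_cvg0 => //; apply: (@le_lt_trans _ _ (120 * C)%:E); last exact: ltry.
  apply: lime_le; first by apply: is_cvg_nneseries.
  apply: nearW => n; rewrite big_mkord.
  apply: (@le_trans _ _ (\sum_(i < n) (60 * C * (i.+1%:R ^+ 2)^-1)%:E)%E).
    by apply: lee_sum => i _; apply: PE.
  rewrite sumEFin lee_fin -mulr_sumr.
  have -> : 120 * C = 60 * C * 2 by ring.
  by rewrite ler_wpM2l ?mulr_ge0 // sum_inv_sqr_le.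
exists (lim_sup_set E); split=> //.
  by apply: bigcap_measurable => // n _; apply: bigcup_measurable => j _; apply: mE.
move=> w; apply: contra_notP => nE.
apply: cvg_of_eighth_powers => // [n|m n mn|].
- by rewrite sums_hist sumr_ge0.
- rewrite !sums_hist -!(big_mkord xpredT (fun t => X (H t w))).
  by rewrite [leRHS](@big_cat_nat _ _ _ m.+1 0 n.+1) //= lerDl sumr_ge0.
have [J HJ] : exists J, forall j, (J <= j)%N -> ~ E j w.
  apply: contrapT => /forallNP nJ; apply: nE => J _.
  by have /existsNP[j /not_implyP[Jj /contrapT Ej]] := nJ J; exists j.
exists J.+1 => //= -[//|j] /= Jj; have /negP := HJ j Jj.
rewrite /bad -leNgt => hj.
have -> : sums X (H (j.+1 ^ 8)%N w) - (j.+1 ^ 8).+1%:R * c =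
   sums (fun h => X h - c) (H (nn j) w).
  by rewrite !sums_hist sumrB sumr_const card_ord mulr_natl.
exact: hj.
Qed.

End StrongLaw.

(** Replaces the centres phi M of the mixing bound, one for each M, by a single constant c at the
    same rate; e n will be the expected value at time n. *)
Lemma harmonic_approx_cvg (R : realType) (e phi : nat -> R) (D : R) :
  0 < D -> (forall M n, (M.+1.*2.+1 <= n)%N -> `|e n - phi M| <= D / M.+1%:R) ->
  exists2 c, e n @[n --> \oo] --> c & forall M, `|phi M - c| <= D / M.+1%:R.
Proof.
move=> D0 ephi.
have /cauchy_cvgP/cvg_ex[/= c ec] : cauchy (e n @[n --> \oo]).
  apply: cauchy_exP => eps eps0; pose M := (Num.trunc (D / eps)).+1.
  exists (phi M); exists (M.+1.*2.+1) => // n /= Mn.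
  rewrite -ball_normE /= distrC; apply: (le_lt_trans (ephi M n Mn)).
  rewrite ltr_pdivrMr // mulrC -ltr_pdivrMr //.
  by apply: (lt_trans (truncnS_gt _)); rewrite ltr_nat.
exists c => // M; rewrite distrC.
have : `|e n - phi M| @[n --> \oo] --> `|c - phi M|.
  by apply: cvg_norm; apply: cvgB => //; apply: cvg_cst.
move=> /cvgr_to_le; apply.
by exists (M.+1.*2.+1) => // n /= Mn; apply: ephi.
Qed.

Section FiniteMemoryLaw.
Context d (T : measurableType d) (R : realType) (P : probability T R).
Variables (S : finType) (xi : nat -> T -> S) (kap : seq S -> S -> R).
Hypothesis kap_ge0 : forall h y, 0 <= kap h y.
Hypothesis kap_sum : forall h, \sum_y kap h y = 1.
Hypothesis kap_markov : forall x h y, kap (x :: h) y = kap [:: x] y.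
Variables (y0 : S) (delta : R).
Hypothesis delta01 : 0 < delta < 1.
Hypothesis kap_delta : forall x, delta <= kap [:: x] y0.
Local Notation H n w := (hist (fun t => xi t w) n).
Hypothesis xi_meas : forall h, measurable [set w | H (size h) w = h].
Hypothesis xi_law : forall h y,
  P [set w | H (size h).+1 w = y :: h] =
  (P [set w | H (size h) w = h] * (kap h y)%:E)%E.

Lemma finite_memory_law (X : seq S -> R) (L : seq S -> nat) (C : R) :
  (forall h, 0 <= X h) -> (forall h, X h <= (size h).+1%:R) ->
  (forall h, (0 < L h)%N) ->
  (forall h M, (L h <= M)%N -> X (take M h) = X h) ->
  (forall t, expect kap t (fun h => (L h)%:R ^+ 4) [::] <= C) ->
  exists2 c : R, expect kap n X [::] @[n --> \oo] --> c &
    {ae P, forall w, sums X (H n w) / n.+1%:R @[n --> \oo] --> c}.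
Proof.
move=> X0 Xs L0 XL LC.
have [C' /choice[phi hphi]] :=
  memory_mixing kap_ge0 kap_sum X0 Xs L0 XL LC kap_markov delta01 kap_delta.
have C'0 : 0 <= C'.
  have := hphi 0%N 0%N; rewrite expr1n divr1; apply: le_trans.
  by apply: expect_ge0 => // h; apply: sqr_ge0.
have sqr_half (a b : R) : (a - b) ^+ 2 <= 2 * a ^+ 2 + 2 * b ^+ 2.
  by have := sqr_ge0 (a + b); nra.
(* Chosen so that D > 0 and C' <= D^2, which avoids a square root. *)
pose D := C' + 1; have D0 : 0 < D by rewrite ltr_wpDl.
have ephi M n : (M.+1.*2.+1 <= n)%N -> `|expect kap n X [::] - phi M| <= D / M.+1%:R.
  move=> Mn; have m0 : 0 < M.+1%:R :> R by rewrite ltr0n.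
  rewrite -(@ler_pXn2r _ 2) ?nnegrE // ?divr_ge0 // ?(ltW D0) ?(ltW m0) //.
  rewrite real_normK ?num_real // exprMn exprVn.
  apply: (@le_trans _ _ (C' / M.+1%:R ^+ 2)); last first.
    by rewrite ler_wpM2r ?invr_ge0 ?exprn_ge0 // /D; nra.
  apply: le_trans (hphi M (n - M.+1.*2.+1)%N).
  rewrite -{1}(subnK Mn) -expect_expect.
  have := expect_sqr kap_ge0 kap_sum (n - M.+1.*2.+1)
    (fun h => expect kap M.+1.*2.+1 X h + - phi M) [::].
  by rewrite expectD expect_cst.
have [c ec phic] := harmonic_approx_cvg D0 ephi.
exists c => //.
have c0 : 0 <= c.
  apply: (cvgr_to_ge ec); apply: nearW => n.
  exact: expect_ge0.
pose C2 := 2 * C' + 2 * D ^+ 2.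
have C20 : 0 <= C2 by rewrite addr_ge0 ?mulr_ge0 ?exprn_ge0 // ltW.
apply: (@strong_law _ _ _ _ _ _ _ kap_ge0 kap_sum xi_meas xi_law X c
  (9 * C2 + (8 * C + 2 * c ^+ 2))) => //.
  move=> t; apply: (@le_trans _ _ (expect kap t (fun h => 2 * X h ^+ 2 + 2 * c ^+ 2) [::])).
    by apply: le_expect => // h; apply: sqr_half.
  rewrite expectD expectZ expect_cst //.
  have := memory_sqr_bounded kap_ge0 X0 Xs L0 XL LC t.
  by move: (expect _ _ _ _) => z; lra.
move=> M t; have m0 : 0 < M.+1%:R :> R by rewrite ltr0n.
have C0 : 0 <= C by apply: le_trans (LC 0%N); apply: expect_ge0 => // h; rewrite exprn_ge0.
apply: (@le_trans _ _ (C2 / M.+1%:R ^+ 2)); last first.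
  rewrite ler_pdivrMr ?exprn_gt0 // mulrAC ler_pdivlMr ?exprn_gt0 ?ltr0n //.
  have h1 : M.+1.*2.+1%:R <= 3 * M.+1%:R :> R by rewrite -natrM ler_nat -muln2; lia.
  have h2 : M.+1.*2.+1%:R ^+ 2 <= 9 * M.+1%:R ^+ 2 :> R.
    have -> : 9 * M.+1%:R ^+ 2 = (3 * M.+1%:R) ^+ 2 :> R by ring.
    by rewrite lerXn2r // nnegrE // mulr_ge0.
  apply: (@le_trans _ _ (C2 * (9 * M.+1%:R ^+ 2))); first by rewrite ler_wpM2l.
  rewrite mulrA ler_wpM2r ?exprn_ge0 // mulrC lerDl.
  by rewrite addr_ge0 ?mulr_ge0 ?exprn_ge0.
apply: (@le_trans _ _ (expect kap t (fun h =>
    2 * (expect kap M.+1.*2.+1 X h - phi M) ^+ 2 + 2 * (D / M.+1%:R) ^+ 2) [::])).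
  apply: le_expect => // h; rewrite expectD expect_cst //.
  have := phic M; rewrite -(@ler_pXn2r _ 2) ?nnegrE // ?divr_ge0 // ?(ltW D0) ?(ltW m0) //.
  rewrite real_normK ?num_real // => h1.
  have := sqr_half (expect kap M.+1.*2.+1 X h - phi M) (c - phi M).
  rewrite opprB addrA subrK -[c - _]opprB sqrrN => /le_trans; apply.
  by rewrite lerD2l ler_wpM2l.
rewrite expectD expectZ expect_cst //.
rewrite /C2 [in leRHS]mulrDl; apply: lerD.
  by rewrite -mulrA ler_wpM2l.
by rewrite exprMn exprVn mulrA.
Qed.

End FiniteMemoryLaw.

(** * Ages as functions of the history *)

(* Arrival indicator and good-channel indicator of a slot. *)
Notation slot := (bool * bool)%type.

Section Backlog.

Implicit Types h s : seq slot.

Fixpoint backlog h : nat :=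
  if h is y :: h' then (backlog h' + y.1 - y.2)%N else 0%N.

(* The number of slots elapsed since the (q+1)-st most recent arrival, or the length
   of the history if there is none. *)
Fixpoint arrival_pos (q : nat) h : nat :=
  if h is y :: h' then
    if y.1 then (if q is q'.+1 then (arrival_pos q' h').+1 else 0%N)
    else (arrival_pos q h').+1
  else 0%N.

(* One less than the FCFS age: the last packet delivered is the most recent one after
   discarding the backlog. *)
Definition fcfs_pos h := arrival_pos (backlog h) h.

Fixpoint plgfs_pos h : nat :=
  if h is y :: h' then
    if y.2 then arrival_pos 0 h else (plgfs_pos h').+1
  else 0%N.

Definition arrivals h : nat := (\sum_(y <- h) y.1)%N.
Definition goods h : nat := (\sum_(y <- h) y.2)%N.

Lemma arrivals_cons y h : arrivals (y :: h) = (y.1 + arrivals h)%N.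
Proof. by rewrite /arrivals big_cons. Qed.

Lemma goods_cons y h : goods (y :: h) = (y.2 + goods h)%N.
Proof. by rewrite /goods big_cons. Qed.

Lemma arrivals_nil : arrivals [::] = 0%N.
Proof. by rewrite /arrivals big_nil. Qed.

Lemma goods_nil : goods [::] = 0%N.
Proof. by rewrite /goods big_nil. Qed.

Lemma arrivals_size h : (arrivals h <= size h)%N.
Proof.
elim: h => [|[[] g] h IH]; rewrite ?arrivals_nil ?arrivals_cons //=; lia.
Qed.

Lemma arrival_pos_size q h : (arrival_pos q h <= size h)%N.
Proof. by elim: h q => [|[[] g] h IH] [|q] /=; rewrite ?ltnS. Qed.

Lemma arrival_pos_mono q q' h : (q <= q')%N -> (arrival_pos q h <= arrival_pos q' h)%N.
Proof.
by elim: h q q' => [|[[] g] h IH] [|q] [|q'] //= qq'; rewrite ltnS; apply: IH.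
Qed.

Lemma arrival_pos_take q M h : arrival_pos q (take M h) = minn M (arrival_pos q h).
Proof.
elim: h q M => [|[[] g] h IH] [|q] [|M] //=; rewrite ?minn0 ?min0n // IH; lia.
Qed.

Lemma plgfs_pos_take M h : plgfs_pos (take M h) = minn M (plgfs_pos h).
Proof.
elim: h M => [|[a g] h IH] [|M] /=; rewrite ?minn0 ?min0n //.
case: g; last by rewrite IH; lia.
by have := arrival_pos_take 0 M.+1 ((a, true) :: h).
Qed.

(** Preemption never yields the older packet. This transfers the FCFS memory to pLGFS and settles
    the good slots in which the FCFS queue is empty. *)
Lemma plgfs_le_fcfs_pos h : (plgfs_pos h <= fcfs_pos h)%N.
Proof.
rewrite /fcfs_pos; elim: h => [|[a g] h IH] //; rewrite [plgfs_pos _]/=.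
case: g; first exact: arrival_pos_mono.
rewrite /= subn0; case: a; last by rewrite addn0 ltnS.
by rewrite addn1 ltnS.
Qed.

Lemma arrivals_le_arrival_pos q h : (q <= arrivals h)%N -> (q <= arrival_pos q h)%N.
Proof.
elim: h q => [|[[] g] h IH] [|q] //=; rewrite ?arrivals_nil ?arrivals_cons //= => qh.
  by rewrite ltnS IH.
by apply: leqW; apply: IH.
Qed.

Lemma arrivals_take_pos q h : (arrivals (take (arrival_pos q h) h) <= q)%N.
Proof.
elim: h q => [|[[] g] h IH] [|q]; rewrite /= ?arrivals_nil ?arrivals_cons //=.
- exact: IH.
- exact: (IH 0%N).
- exact: (IH q.+1).
Qed.

Lemma backlog_arrivals h : (backlog h <= arrivals h)%N.
Proof. by elim: h => [|y h IH] //=; rewrite arrivals_cons; lia. Qed.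

Lemma backlog_take_le M h : (backlog (take M h) <= backlog h)%N.
Proof.
elim: h M => [|y h IH] [|M] //=.
by apply: leq_sub2r; rewrite leq_add2r.
Qed.

Lemma backlog_busy_period h : exists m,
  [/\ (m <= size h)%N, (backlog h + goods (take m h) = arrivals (take m h))%N &
      forall M, (m <= M)%N -> backlog (take M h) = backlog h].
Proof.
elim: h => [|y h [m [mh e tk]]]; first by exists 0%N; rewrite goods_nil arrivals_nil.
have [gQ|gQ] := leqP (y.2 : nat) (backlog h + y.1).
  exists m.+1; split=> //=; first by rewrite goods_cons arrivals_cons; lia.
  by case=> [//|M] /= mM; rewrite tk.
exists 0%N; split=> //=.
  by rewrite goods_nil arrivals_nil; lia.
case=> [|M] _ /=; first by lia.
by have := backlog_take_le M h; lia.
Qed.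

(* Windows that may start with a busy period still in progress, and windows too poor
   in arrivals to locate the last delivered packet. *)
Definition overloaded s := (goods s <= arrivals s)%N.
Definition sparse K s := (K * arrivals s <= size s)%N.

Definition memory K h : nat :=
  (last_bad (sparse K) h + K * last_bad overloaded h).+1.

Lemma backlog_memory h :
  (backlog h <= last_bad overloaded h)%N /\
  (forall M, (last_bad overloaded h <= M)%N -> backlog (take M h) = backlog h).
Proof.
have [m [mh e tk]] := backlog_busy_period h.
have mN : (m <= last_bad overloaded h)%N.
  by apply: last_bad_ge => //; rewrite /overloaded -e leq_addl.
split=> [|M NM]; last exact: tk (leq_trans mN NM).
apply: leq_trans mN; have := arrivals_size (take m h).
by rewrite size_take_min; lia.
Qed.

(** The m slots after the generation of the last delivered packet contain at most [backlog h]
    arrivals. Either this window is sparse, or m is below K times that backlog, which the longest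
    overloaded window bounds. The two summands of [memory] are these two cases. *)
Lemma fcfs_pos_memory K h : (fcfs_pos h < memory K h)%N.
Proof.
rewrite ltnS; set m := fcfs_pos h.
have mh : (m <= size h)%N by apply: arrival_pos_size.
have [Qh _] := backlog_memory h.
have am : (arrivals (take m h) <= backlog h)%N by apply: arrivals_take_pos.
have [sp|/negbTE nsp] := boolP (sparse K (take m h)).
  by apply: leq_trans (last_bad_ge mh sp) (leq_addr _ _).
move: nsp; rewrite /sparse size_takel // => /negbT; rewrite -ltnNge => /ltnW mK.
apply: leq_trans mK (leq_trans _ (leq_addl _ _)).
by rewrite leq_mul2l (leq_trans am Qh) orbT.
Qed.

Lemma fcfs_pos_take K h M : (0 < K)%N -> (memory K h <= M)%N ->
  fcfs_pos (take M h) = fcfs_pos h.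
Proof.
move=> K0 LM; have [_ tk] := backlog_memory h.
rewrite /fcfs_pos tk; last first.
  apply: leq_trans LM; apply: leqW; apply: leq_trans (leq_addl _ _).
  by rewrite leq_pmull.
rewrite arrival_pos_take; apply/minn_idPr.
by apply: leq_trans LM; apply/ltnW/fcfs_pos_memory.
Qed.

Lemma plgfs_pos_take_memory K h M : (memory K h <= M)%N ->
  plgfs_pos (take M h) = plgfs_pos h.
Proof.
move=> LM; rewrite plgfs_pos_take; apply/minn_idPr.
apply: leq_trans LM; apply: leq_trans (plgfs_le_fcfs_pos h) _.
by apply/ltnW/fcfs_pos_memory.
Qed.

Lemma plgfs_pos_size h : (plgfs_pos h <= size h)%N.
Proof. exact: leq_trans (plgfs_le_fcfs_pos h) (arrival_pos_size _ _). Qed.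

End Backlog.

Lemma sum_slot (R : nmodType) (f : slot -> R) :
  \sum_y f y = f (true, true) + f (true, false) + (f (false, true) + f (false, false)).
Proof.
rewrite (eq_bigr (fun y => f (y.1, y.2))); last by case.
by rewrite -(pair_bigA _ (fun a g => f (a, g))) /= !big_bool.
Qed.

(* An exponential Lyapunov function for arrivals minus good slots: to first order in
   1 - zeta, weights vB / vG = 1 + (t - 1)(1 - zeta) decrease in mean iff
   lambda / r < t < (1 - lambda) / p, and such t exist iff lambda < r / (p + r). *)
Lemma drift_weights (R : realType) (p r lambda : R) :
  0 < p < 1 -> 0 < r < 1 -> 0 < lambda < r / (p + r) ->
  exists zeta vG vB rho : R, [/\ 0 < zeta < 1, 1 <= vG, 1 <= vB, 0 < rho < 1 &
    (lambda / zeta + (1 - lambda)) * ((1 - p) * (zeta * vG) + p * vB) <= rho * vG /\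
    (lambda / zeta + (1 - lambda)) * (r * (zeta * vG) + (1 - r) * vB) <= rho * vB].
Proof.
move=> /andP[p0 p1] /andP[r0 r1] /andP[l0 lr].
have pr0 : 0 < p + r by rewrite addr_gt0.
have lpr : lambda * (p + r) < r by rewrite -ltr_pdivlMr.
have l1 : lambda < 1 by nra.
have [t /andP[lt tl]] : exists t, lambda / r < t < (1 - lambda) / p.
  have lrp : lambda / r < (1 - lambda) / p.
    by rewrite ltr_pdivrMr // mulrAC ltr_pdivlMr //; nra.
  by exists ((lambda / r + (1 - lambda) / p) / 2); rewrite !midf_lt.
move: lt tl; rewrite ltr_pdivrMr // ltr_pdivlMr // => lt tl.
have t0 : 0 < t by rewrite -(pmulr_lgt0 _ r0); lra.
pose a := 1 - p * t; have la : lambda < a by rewrite /a; lra.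
have a1 : a <= 1 by rewrite /a gerBl mulr_ge0 // ltW.
(* With e = 1 - zeta and weights 1 and w, the good-state inequality reduces to a (1 - lambda) e < a
   - lambda, the bad-state one to lambda (w - e r t) < (1 - e) r t. e1 and e2 are half the
   thresholds of simple sufficient conditions. *)
pose e1 := (a - lambda) / 2; pose e2 := (t * r - lambda) / (2 * (lambda * t + r * t)).
have den0 : 0 < lambda * t + r * t by rewrite addr_gt0 // mulr_gt0.
have e10 : 0 < e1 by rewrite divr_gt0 // subr_gt0.
have e20 : 0 < e2 by rewrite divr_gt0 ?mulr_gt0 // subr_gt0.
pose e := Num.min (1 / 2) (Num.min e1 e2).
have e0 : 0 < e by rewrite !lt_min e10 e20 divr_gt0.
have [ee ee1 ee2] : [/\ e <= 1 / 2, e <= e1 & e <= e2].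
  by rewrite /e !ge_min !lexx !orbT.
have z0 : 0 < 1 - e by lra.
pose w := 1 + (t - 1) * e; have w0 : 0 < w by rewrite /w; nra.
have hG : (lambda / (1 - e) + (1 - lambda)) * ((1 - p) * ((1 - e) * 1) + p * w) < 1.
  have -> : (lambda / (1 - e) + (1 - lambda)) * ((1 - p) * ((1 - e) * 1) + p * w) =
     (1 - e + lambda * e) * (1 - a * e) / (1 - e).
    by rewrite /w /a; field; rewrite lt0r_neq0.
  rewrite ltr_pdivrMr // mul1r.
  have : a * (1 - lambda) * e < a - lambda.
    apply: (@le_lt_trans _ _ e); last by move: ee1; rewrite /e1; lra.
    by rewrite ler_piMl ?ltW //; nra.
  by move: e0; nra.
have hB : (lambda / (1 - e) + (1 - lambda)) * (r * ((1 - e) * 1) + (1 - r) * w) < w.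
  have -> : (lambda / (1 - e) + (1 - lambda)) * (r * ((1 - e) * 1) + (1 - r) * w) =
     (1 - e + lambda * e) * (w - e * (r * t)) / (1 - e).
    by rewrite /w; field; rewrite lt0r_neq0.
  rewrite ltr_pdivrMr //.
  have h1 : e * (lambda * t + r * t) < r * t - lambda.
    apply: (@le_lt_trans _ _ (e2 * (lambda * t + r * t))); first by rewrite ler_pM2r.
    have -> : e2 * (lambda * t + r * t) = (r * t - lambda) / 2.
      by rewrite /e2; field; rewrite lt0r_neq0.
    by nra.
  have h2 : lambda * (w - e * (r * t)) < (1 - e) * (r * t).
    have : 0 < lambda * e by rewrite mulr_gt0.
    have : 0 < lambda * e * (r * t) by rewrite !mulr_gt0.
    by rewrite /w; nra.
  have : e * (lambda * (w - e * (r * t))) < e * ((1 - e) * (r * t)) by rewrite ltr_pM2l.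
  by rewrite /w; nra.
(* The inequalities are homogeneous in the weights, so dividing by m makes both weights at least 1,
   as the Chernoff bound requires. *)
pose m := Num.min 1 w; have m0 : 0 < m by rewrite lt_min ltr01 w0.
set cG := (_ * _) in hG; set cB := (_ * _) in hB.
have cG0 : 0 < cG.
  rewrite /cG; apply: mulr_gt0; apply: addr_gt0;
    rewrite ?subr_gt0 ?divr_gt0 // !mulr_gt0 ?subr_gt0 //; lra.
pose rho := Num.max cG (cB / w).
exists (1 - e), (1 / m), (w / m), rho; split.
- by rewrite z0 /=; lra.
- by rewrite ler_pdivlMr // mul1r ge_min lexx.
- by rewrite ler_pdivlMr // mul1r ge_min lexx orbT.
- by rewrite lt_max cG0 gt_max hG ltr_pdivrMr // mul1r hB.
split.
  have -> : (lambda / (1 - e) + (1 - lambda)) *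
     ((1 - p) * ((1 - e) * (1 / m)) + p * (w / m)) = cG / m by rewrite /cG; ring.
  by rewrite mulrA mulr1 ler_pM2r ?invr_gt0 // le_max lexx.
have -> : (lambda / (1 - e) + (1 - lambda)) *
   (r * ((1 - e) * (1 / m)) + (1 - r) * (w / m)) = cB / m by rewrite /cB; ring.
by rewrite mulrA ler_pM2r ?invr_gt0 // -ler_pdivrMr // le_max lexx orbT.
Qed.

(** * The slot kernel and the moments of its memory *)

Section Kernel.
Variables (R : realType) (p r lambda : R) (mu : bool -> R).
Hypothesis hp : 0 < p < 1.
Hypothesis hr : 0 < r < 1.
Hypothesis hlambda : 0 < lambda < r / (p + r).
Hypothesis mu_ge0 : forall g, 0 <= mu g.
Hypothesis mu_sum : mu true + mu false = 1.

Definition bernoulli_weight (a : bool) : R := if a then lambda else 1 - lambda.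

Definition slot_kernel (h : seq slot) (y : slot) : R :=
  bernoulli_weight y.1 * (if h is x :: _ then GE_trans p r x.2 y.2 else mu y.2).

Lemma lambda_lt1 : lambda < 1.
Proof.
case/andP: hp hr hlambda => p0 p1 /andP[r0 r1] /andP[l0].
by rewrite ltr_pdivlMr ?addr_gt0 //; nra.
Qed.

Lemma slot_kernel_ge0 h y : 0 <= slot_kernel h y.
Proof.
have l1 := lambda_lt1; case/andP: hp hr hlambda => p0 p1 /andP[r0 r1] /andP[l0 _].
rewrite /slot_kernel mulr_ge0 //; first by rewrite /bernoulli_weight; case: y.1; lra.
by case: h => [//|[? []] ?]; case: y.2 => /=; lra.
Qed.

Lemma slot_kernel_sum h : \sum_y slot_kernel h y = 1.
Proof.
rewrite sum_slot /slot_kernel /bernoulli_weight /=.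
case: h => [|[? []] ?] /=; try by ring.
have e := mu_sum; rewrite -!mulrDr e; ring.
Qed.

Lemma slot_kernel_markov x h y : slot_kernel (x :: h) y = slot_kernel [:: x] y.
Proof. by []. Qed.

Lemma slot_kernel_doeblin : exists2 delta, 0 < delta < 1 &
  forall x, delta <= slot_kernel [:: x] (true, true).
Proof.
have l1 := lambda_lt1; case/andP: hp hr hlambda => p0 p1 /andP[r0 r1] /andP[l0 _].
exists (lambda * Num.min (1 - p) r).
  apply/andP; split; first by rewrite mulr_gt0 // lt_min subr_gt0 p1 r0.
  apply: (@le_lt_trans _ _ lambda) => //.
  by rewrite ler_piMr ?(ltW l0) // ge_min (ltW r1) orbT.
move=> [a []]; rewrite /slot_kernel /bernoulli_weight /= ler_pM2l // ge_min lexx //.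
by rewrite orbT.
Qed.

Local Notation expect := (expect slot_kernel).

Lemma overloaded_moment : exists C, forall t,
  expect t (fun h => (last_bad overloaded h)%:R ^+ 4) [::] <= C.
Proof.
have [zeta [vG [vB [rho [/andP[z0 z1] vG1 vB1 /andP[rho0 rho1] [dG dB]]]]]] :=
  drift_weights hp hr hlambda.
have l1 := lambda_lt1; case/andP: hp hr hlambda => p0 p1 /andP[r0 r1] /andP[l0 _].
pose psi (y : slot) : R := (if y.1 then zeta^-1 else 1) * (if y.2 then zeta else 1).
(* V is the weight of the empty history, where the next state follows [mu] instead of the channel
   kernel; it is large enough for the drift inequality under any initial law. *)
pose V := (lambda / zeta + (1 - lambda)) * (vG + vB) / rho + vG + vB.
have b0 : 0 < lambda / zeta + (1 - lambda) by rewrite addr_gt0 ?divr_gt0 // subr_gt0.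
have bV0 : 0 <= (lambda / zeta + (1 - lambda)) * (vG + vB) / rho.
  by rewrite divr_ge0 ?mulr_ge0 ?(ltW b0) ?(ltW rho0) //; lra.
pose v (h : seq slot) := if h is x :: _ then (if x.2 then vG else vB) else V.
apply: (@last_bad_moment _ _ slot_kernel slot_kernel_ge0 slot_kernel_sum psi v rho V).
- move=> y; rewrite /psi mulr_ge0 //; first by case: y.1; rewrite // invr_ge0 ltW.
  by case: y.2; rewrite // ltW.
- move=> [|x h] /=; rewrite /V; first by rewrite lexx andbT; lra.
  by case: x.2; lra.
- by rewrite rho1 ltW.
- move=> h; rewrite sum_slot /slot_kernel /bernoulli_weight /psi /=.
  case: h => [|[a [] ] h] /=.
  + have m1 : mu true <= 1 by have := mu_ge0 false; have := mu_sum; lra.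
    have m2 : mu false <= 1 by have := mu_ge0 true; have := mu_sum; lra.
    apply: (@le_trans _ _ ((lambda / zeta + (1 - lambda)) *
        (mu true * (zeta * vG) + mu false * vB))).
      by rewrite le_eqVlt; apply/orP; left; apply/eqP; field; rewrite lt0r_neq0.
    apply: (@le_trans _ _ ((lambda / zeta + (1 - lambda)) * (vG + vB))).
      rewrite ler_pM2l // lerD //.
        have : zeta * vG <= vG by rewrite ler_piMl ?ltW //; lra.
        apply: le_trans; rewrite ler_piMl // mulr_ge0 ?ltW //; lra.
      by rewrite ler_piMl //; lra.
    have -> : rho * V = (lambda / zeta + (1 - lambda)) * (vG + vB) + rho * (vG + vB).
      by rewrite /V; field; rewrite !lt0r_neq0.
    by rewrite lerDl mulr_ge0 ?(ltW rho0) //; lra.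
  + apply: le_trans dG; rewrite le_eqVlt; apply/orP; left; apply/eqP.
    by field; rewrite lt0r_neq0.
  + apply: le_trans dB; rewrite le_eqVlt; apply/orP; left; apply/eqP.
    by field; rewrite lt0r_neq0.
- move=> s; rewrite /overloaded => gs.
  have -> : \prod_(y <- s) psi y = zeta^-1 ^+ arrivals s * zeta ^+ goods s.
    elim: s {gs} => [|[a g] s IH].
      by rewrite big_nil arrivals_nil goods_nil mulr1.
    rewrite big_cons IH arrivals_cons goods_cons /psi /=.
    by case: a; case: g; rewrite ?add1n ?add0n ?exprS; ring.
  rewrite -(subnK gs) exprD -mulrA -exprMn mulVf ?lt0r_neq0 // expr1n mulr1.
  by rewrite exprn_ege1 // invf_ge1 // ltW.
Qed.

Lemma sparse_moment : exists2 K, (0 < K)%N & exists C, forall t,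
  expect t (fun h => (last_bad (sparse K) h)%:R ^+ 4) [::] <= C.
Proof.
have l1 := lambda_lt1; have /andP[l0 _] := hlambda.
(* With z^K <= 1/4 the tilt z^(K a) / z of one slot has mean at most (1 - 3 lambda / 4) / (1 -
   lambda / 4) < 1, whereas its product over a sparse window is at least 1. *)
pose z := 1 - lambda / 4; have z0 : 0 < z by rewrite /z; lra.
have z1 : z < 1 by rewrite /z; lra.
have [K K0 zK] : exists2 K, (0 < K)%N & z ^+ K <= 1 / 4.
  have [|C hC] := @poly_geometric_bounded R z 1; first by rewrite ltW.
  pose K := (Num.trunc (4 * C)).+1; exists K => //.
  have CK : 4 * C < K.+1%:R by apply: lt_trans (truncnS_gt _) _; rewrite ltr_nat.
  have k0 : 0 < K.+1%:R :> R by rewrite ltr0n.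
  rewrite -(ler_pM2l k0); apply: le_trans (hC K) _; lra.
exists K => //.
pose psi (y : slot) : R := (if y.1 then z ^+ K else 1) / z.
apply: (@last_bad_moment _ _ slot_kernel slot_kernel_ge0 slot_kernel_sum psi (fun=> 1)
  ((1 - 3 / 4 * lambda) / z) 1).
- by move=> y; rewrite divr_ge0 ?(ltW z0) //; case: y.1; rewrite ?exprn_ge0 ?(ltW z0).
- by move=> h; rewrite !lexx.
- apply/andP; split; first by rewrite divr_ge0 ?(ltW z0) //; lra.
  by rewrite ltr_pdivrMr // /z; lra.
- move=> h.
  have -> : \sum_y slot_kernel h y * (psi y * 1) = (lambda * z ^+ K + (1 - lambda)) / z.
    rewrite sum_slot /slot_kernel /bernoulli_weight /psi /=.
    have [q e] : exists q, (if h is x :: _ then GE_trans p r x.2 true else mu true) = q /\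
       (if h is x :: _ then GE_trans p r x.2 false else mu false) = 1 - q.
      case: h => [|[? []] ?] /=; eexists; split=> //; try ring.
      by have := mu_sum; lra.
    by case: e => -> ->; ring.
  rewrite mulr1 ler_pM2r ?invr_gt0 //.
  have : lambda * z ^+ K <= lambda * (1 / 4) by rewrite ler_pM2l.
  by lra.
- move=> s; rewrite /sparse => sK.
  have -> : \prod_(y <- s) psi y = z ^+ (K * arrivals s) / z ^+ size s.
    elim: s {sK} => [|[a g] s IH].
      by rewrite big_nil arrivals_nil muln0 divr1.
    rewrite big_cons IH arrivals_cons /psi /= mulnDr exprD exprS invfM.
    by case: a; rewrite ?muln1 ?muln0 ?expr0; ring.
  rewrite ler_pdivlMr ?exprn_gt0 // mul1r.
  by rewrite ler_wiXn2l // ltW.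
Qed.

Lemma memory_moment : exists2 K, (0 < K)%N & exists C, forall t,
  expect t (fun h => (memory K h)%:R ^+ 4) [::] <= C.
Proof.
have [K K0 [C1 hC1]] := sparse_moment; have [C2 hC2] := overloaded_moment.
exists K => //; exists (64 * C1 + (64 * K%:R ^+ 4 * C2 + 8)) => t.
apply: (@le_trans _ _ (expect t (fun h => 64 * (last_bad (sparse K) h)%:R ^+ 4 +
   (64 * K%:R ^+ 4 * (last_bad overloaded h)%:R ^+ 4 + 8)) [::])).
  apply: le_expect => [|h]; first exact: slot_kernel_ge0.
  have pow4 (a b : R) : (a + b) ^+ 4 <= 8 * a ^+ 4 + 8 * b ^+ 4.
    have h1 : (a + b) ^+ 2 <= 2 * a ^+ 2 + 2 * b ^+ 2 by have := sqr_ge0 (a - b); nra.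
    have h2 : (2 * a ^+ 2 + 2 * b ^+ 2) ^+ 2 <= 8 * (a ^+ 2) ^+ 2 + 8 * (b ^+ 2) ^+ 2.
      by move: (a ^+ 2) (b ^+ 2) => z w; have := sqr_ge0 (z - w); nra.
    rewrite !(exprM _ 2 2); apply: le_trans h2.
    by rewrite lerXn2r // nnegrE ?sqr_ge0 // addr_ge0 // mulr_ge0 // sqr_ge0.
  rewrite /memory -natr1 natrD natrM.
  move: (last_bad (sparse K) h)%:R (last_bad overloaded h)%:R => x y.
  have := pow4 (x + K%:R * y) 1; have := pow4 x (K%:R * y).
  rewrite exprMn expr1n -[64 * K%:R ^+ 4 * _]mulrA.
  by move: ((x + K%:R * y) ^+ 4) ((x + K%:R * y + 1) ^+ 4) (x ^+ 4) (K%:R ^+ 4 * y ^+ 4) => *; lra.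
rewrite !expectD !expectZ expect_cst; last exact: slot_kernel_sum.
by rewrite lerD ?ler_wpM2l // lerD2r ler_wpM2l // mulr_ge0 // exprn_ge0.
Qed.

End Kernel.

(** * The law of the slot histories in the given model *)

Section ModelLaw.
Context d (T : measurableType d) (R : realType) (P : probability T R).
Variables (arr chan : nat -> {RV P >-> bool}) (p r lambda : R).
Hypothesis harr : bernoulli_arrivals arr lambda.
Hypothesis hchan : GE_channel chan p r.
Hypothesis hindep : independent_processes arr chan.

Definition slots (t : nat) (w : T) : slot := (arr t w, chan t w).
Definition initial_law (g : bool) : R := fine (P [set w | chan 1%N w = g]).

Local Notation H n w := (hist (fun t => slots t w) n).

Lemma measurable_rv_eq (X : {RV P >-> bool}) (b : bool) : measurable [set w | X w = b].
Proof. exact: (@measurable_funPTI _ _ _ _ X [set b]). Qed.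

Lemma measurable_cylinder (X : nat -> {RV P >-> bool}) s x : measurable (cylinder X s x).
Proof.
have -> : cylinder X s x = \bigcap_(t in [set` s]) [set w | X t w = x t].
  by apply/seteqP; split=> w /= h t /h.
apply: fin_bigcap_measurable; first exact: finite_seq.
by move=> t _; apply: measurable_rv_eq.
Qed.

Lemma eq_cylinder (X : nat -> {RV P >-> bool}) s x y :
  {in s, x =1 y} -> cylinder X s x = cylinder X s y.
Proof. by move=> xy; apply/seteqP; split=> w /= h t ts; rewrite h // xy. Qed.

Lemma prob_bool (X : {RV P >-> bool}) :
  (P [set w | X w = true] + P [set w | X w = false] = 1)%E.
Proof.
rewrite -measureU; try exact: measurable_rv_eq; last first.
  by rewrite -subset0 => w [/= ->].
rewrite -[RHS](probability_setT P); congr (P _).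
by rewrite -subTset => w _ /=; case: (X w); [left|right].
Qed.

Lemma prob_arr t b : (0 < t)%N ->
  P [set w | arr t w = b] = (bernoulli_weight lambda b)%:E.
Proof.
move=> t0; have [h _] := harr; case: b; first exact: h.
have := prob_bool (arr t); rewrite h //.
have : P [set w | arr t w = false] \is a fin_num by apply: fin_num_measure; apply: measurable_rv_eq.
move/fineK <-; rewrite -EFinD => -[e]; congr (_%:E); rewrite /=; lra.
Qed.

Lemma initial_law_ge0 g : 0 <= initial_law g.
Proof. exact: fine_ge0. Qed.

Lemma initial_lawE g : P [set w | chan 1%N w = g] = (initial_law g)%:E.
Proof. by rewrite fineK //; apply: fin_num_measure; apply: measurable_rv_eq. Qed.

Lemma initial_law_sum : initial_law true + initial_law false = 1.
Proof.
have := prob_bool (chan 1%N); rewrite !initial_lawE -EFinD.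
by move=> [].
Qed.

Definition slot_at (h : seq slot) (t : nat) : slot := nth (false, false) h (size h - t).

Lemma slot_at_cons y h t : (t <= size h)%N -> slot_at (y :: h) t = slot_at h t.
Proof. by move=> th; rewrite /slot_at /= subSn. Qed.

Lemma slot_at_last y h : slot_at (y :: h) (size h).+1 = y.
Proof. by rewrite /slot_at subnn. Qed.

Lemma hist_slot_at (x : nat -> slot) h : hist x (size h) = h <->
  (forall t, t \in iota 1 (size h) -> x t = slot_at h t).
Proof.
elim: h => [|y h IH]; first by split.
split=> [[e /IH eh] t|ht].
  rewrite mem_iota add1n => /andP[t0]; rewrite ltnS leq_eqVlt => /orP[/eqP ->|th].
    by rewrite slot_at_last.
  by rewrite slot_at_cons // eh // mem_iota t0 add1n.
rewrite /= ht ?slot_at_last; last by rewrite mem_iota add1n ltnS leqnn.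
congr cons; apply/IH => t; rewrite mem_iota add1n => /andP[t0 th].
by rewrite ht ?slot_at_cons // mem_iota t0 add1n ltnS /= ltnW.
Qed.

Lemma hist_event_cylinder h : [set w | H (size h) w = h] =
  cylinder arr (iota 1 (size h)) (fun t => (slot_at h t).1) `&`
  cylinder chan (iota 1 (size h)) (fun t => (slot_at h t).2).
Proof.
apply/seteqP; split=> [w /= /hist_slot_at e|w [ea ec]].
  by split=> t /e; rewrite /slots => <-.
apply/hist_slot_at => t th; rewrite /slots.
by move: (ea t th) (ec t th) => -> ->; case: (slot_at h t).
Qed.

Lemma slots_measurable h : measurable [set w | H (size h) w = h].
Proof.
by rewrite hist_event_cylinder; apply: measurableI; apply: measurable_cylinder.
Qed.

(** Independence splits the cylinder into an arrival and a channel factor, each extended by one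
    slot. [GE_channel] starts at the second slot, so the empty history takes the law of the first
    channel state. *)
Lemma slots_law h y : P [set w | H (size h).+1 w = y :: h] =
  (P [set w | H (size h) w = h] * (slot_kernel p r lambda initial_law h y)%:E)%E.
Proof.
have all1 n : all (leq 1) (iota 1 n) by apply/allP => t; rewrite mem_iota => /andP[].
have agree (f : slot -> bool) : {in iota 1 (size h),
    (fun t => f (slot_at (y :: h) t)) =1 (fun t => f (slot_at h t))}.
  by move=> t; rewrite mem_iota add1n ltnS => /andP[_ th] /=; rewrite slot_at_cons.
have := hist_event_cylinder (y :: h); rewrite /= => ->.
rewrite hist_event_cylinder !hindep; try exact: all1; try exact: (all1 (size h).+1).
rewrite /slot_kernel EFinM.
have [_ hprod] := harr.
have -> : P (cylinder arr (1%N :: iota 2 (size h)) (fun t => (slot_at (y :: h) t).1)) =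
   (P (cylinder arr (iota 1 (size h)) (fun t => (slot_at h t).1)) *
    (bernoulli_weight lambda y.1)%:E)%E.
  rewrite -[1%N :: _]/(iota 1 (size h).+1) !hprod ?iota_uniq //.
  have -> : iota 1 (size h).+1 = iota 1 (size h) ++ [:: (size h).+1].
    by rewrite -[(size h).+1]addn1 iotaD add1n addn1.
  rewrite big_cat big_seq1 /= slot_at_last prob_arr //.
  by congr (_ * _)%E; apply: eq_big_seq => t th /=; rewrite (agree fst).
have -> : P (cylinder chan (1%N :: iota 2 (size h)) (fun t => (slot_at (y :: h) t).2)) =
   (P (cylinder chan (iota 1 (size h)) (fun t => (slot_at h t).2)) *
    (if h is x :: _ then GE_trans p r x.2 y.2 else initial_law y.2)%:E)%E.
  rewrite -[1%N :: _]/(iota 1 (size h).+1).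
  case: h agree => [|x h] agree.
    rewrite (_ : cylinder _ (iota 1 (size [::])) _ = setT); last first.
      by apply/seteqP; split.
    rewrite probability_setT mul1e -initial_lawE; congr (P _).
    apply/seteqP; split=> [w /= hw|w /= hw t].
      by have := hw 1%N (mem_head _ _); rewrite /slot_at.
    by rewrite inE => /eqP ->; rewrite hw.
  rewrite hchan //; congr (_ * (GE_trans p r _ _)%:E)%E.
  - by rewrite (eq_cylinder _ (agree snd)).
  - by rewrite slot_at_cons // slot_at_last.
  - by rewrite slot_at_last.
set u := P _; set v := P _.
by rewrite muleACA.
Qed.

End ModelLaw.

(** * The sample-path identity *)

Section Path.
Local Open Scope nat_scope.
Variables a g : nat -> bool.

Local Notation history n := (hist (fun t => (a t, g t)) n).

Fixpoint packets n : seq nat :=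
  if n is m.+1 then (if a m.+1 then rcons (packets m) m.+1 else packets m) else [::].

Fixpoint served n : seq nat :=
  if n is m.+1 then
    (if fcfs_delivered a g m.+1 is Some k then rcons (served m) k else served m)
  else [::].

Definition carried n := if g n then behead (fcfs_queue a g n) else fcfs_queue a g n.

Lemma fcfs_queueS n : fcfs_queue a g n.+1 =
  if a n.+1 then rcons (carried n) n.+1 else carried n.
Proof. by []. Qed.

(** The FCFS invariant: served packets followed by the queue are all packets in order of generation,
    both before and after the transmission of a slot. *)
Lemma served_queue n : packets n.+1 = served n ++ fcfs_queue a g n.+1 /\
  packets n = served n ++ carried n.
Proof.
have queue m : packets m = served m ++ carried m ->
    packets m.+1 = served m ++ fcfs_queue a g m.+1.
  by move=> e; rewrite fcfs_queueS /= e; case: (a m.+1) => //; rewrite rcons_cat.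
suff h m : packets m = served m ++ carried m by split=> //; apply: queue.
elim: m => [|m IH]; first by rewrite /carried /=; case: (g 0).
rewrite (queue _ IH) [served m.+1]/= /fcfs_delivered /carried.
case: (g m.+1) => //; case: (fcfs_queue a g m.+1) => [|k q] //=.
by rewrite cat_rcons.
Qed.

Lemma packets_served n : packets n = served n ++ carried n.
Proof. by have [] := served_queue n. Qed.

Lemma size_packets n : size (packets n) = arrivals (history n).
Proof.
elim: n => [|n IH] /=; first by rewrite arrivals_nil.
by rewrite arrivals_cons /= -IH; case: (a n.+1); rewrite // size_rcons.
Qed.

Lemma size_carried n : size (carried n) = backlog (history n).
Proof.
elim: n => [|n IH]; first by rewrite /carried /=; case: (g 0).
rewrite /carried fcfs_queueS [backlog _]/= -IH.
have -> : size (carried n) + a n.+1 =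
    size (if a n.+1 then rcons (carried n) n.+1 else carried n).
  by case: (a n.+1); rewrite ?size_rcons ?addn1 ?addn0.
by case: (g n.+1); rewrite ?size_behead ?subn1 ?subn0.
Qed.

Lemma size_served n : size (served n) + backlog (history n) = size (packets n).
Proof. by rewrite -size_carried packets_served size_cat. Qed.

Lemma packets_sorted n : path ltn 0 (packets n) /\ last 0 (packets n) <= n.
Proof.
elim: n => [|n [p l]] //=; case: (a n.+1); last by split=> //; apply: leqW.
by rewrite rcons_path p last_rcons.
Qed.

(** The prepended 0 makes packet numbers start at 1 and doubles as the value reached when there are
    too few arrivals, in agreement with [latest_received] before the first delivery. *)
Lemma arrival_posE q n :
  arrival_pos q (history n) + nth 0 (0 :: packets n) (size (packets n) - q) = n.
Proof.
elim: n q => [|n IH] q //; rewrite [packets _]/= [history _]/=.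
case: (a n.+1) (IH) => {}IH /=; last by rewrite addSn IH.
rewrite size_rcons; case: q => [|q] /=.
  by rewrite nth_rcons ltnn eqxx.
rewrite subSS addSn -[in RHS](IH q); congr (_ + _).+1.
case e: (size _ - q) => [|k] //=; rewrite nth_rcons ifT //; lia.
Qed.

Lemma nth_last0 (s : seq nat) : nth 0 (0 :: s) (size s) = last 0 s.
Proof. by case: s => [|x s] //=; rewrite (last_nth 0). Qed.

Lemma last_packetE n : arrival_pos 0 (history n) + last 0 (packets n) = n.
Proof. by rewrite -nth_last0 -[X in nth _ _ X]subn0 arrival_posE. Qed.

Lemma latest_receivedS (delivered : nat -> option nat) n :
  latest_received delivered n.+2 =
  maxn (latest_received delivered n.+1) (odflt 0 (delivered n.+1)).
Proof. by rewrite /latest_received big_nat_recr. Qed.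

Lemma latest_received1 (delivered : nat -> option nat) : latest_received delivered 1 = 0.
Proof. by rewrite /latest_received big_geq. Qed.

Lemma fcfs_latest_received n :
  latest_received (fcfs_delivered a g) n.+1 = last 0 (served n).
Proof.
elim: n => [|n IH]; first by rewrite latest_received1.
rewrite latest_receivedS IH /=.
have [e _] := served_queue n; have [p _] := packets_sorted n.+1.
move: p; rewrite e cat_path => /andP[_]; rewrite /fcfs_delivered.
case: (g n.+1); last by rewrite /= maxn0.
case: (fcfs_queue a g n.+1) => [|k q] /=; first by rewrite maxn0.
by case/andP=> lk _; rewrite last_rcons; apply/maxn_idPr/ltnW.
Qed.

Lemma fcfs_posE n :
  fcfs_pos (history n) + latest_received (fcfs_delivered a g) n.+1 = n.
Proof.
rewrite fcfs_latest_received -nth_last0 -[RHS](arrival_posE (backlog (history n)) n).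
rewrite -size_served addnK packets_served; congr (_ + _).
by rewrite -cat_cons nth_cat /= ltnSn.
Qed.

(** A packet sent in a good slot n stays in [plgfs_held] at n and is dropped only at n + 1. Hence
    the separate clause for g n beside the one for an empty hold. *)
Lemma plgfs_invariant n :
  [/\ latest_received (plgfs_delivered a g) n.+1 <= last 0 (packets n),
      g n -> latest_received (plgfs_delivered a g) n.+1 = last 0 (packets n) &
      if plgfs_held a g n is Some k then k = last 0 (packets n)
      else latest_received (plgfs_delivered a g) n.+1 = last 0 (packets n)] /\
  latest_received (plgfs_delivered a g) n.+2 =
    if g n.+1 then last 0 (packets n.+1) else latest_received (plgfs_delivered a g) n.+1.
Proof.
have next m : 
  [/\ latest_received (plgfs_delivered a g) m.+1 <= last 0 (packets m),
      g m -> latest_received (plgfs_delivered a g) m.+1 = last 0 (packets m) &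
      if plgfs_held a g m is Some k then k = last 0 (packets m)
      else latest_received (plgfs_delivered a g) m.+1 = last 0 (packets m)] ->
  latest_received (plgfs_delivered a g) m.+2 =
    if g m.+1 then last 0 (packets m.+1) else latest_received (plgfs_delivered a g) m.+1.
  case=> ule ug uh; rewrite latest_receivedS /plgfs_delivered.
  case: (g m.+1); last by rewrite maxn0.
  have [_ lm] := packets_sorted m.
  rewrite /=; case: (a m.+1).
    by rewrite last_rcons; apply/maxn_idPr/(leq_trans ule)/leqW.
  case gm: (g m) ug => ug; first by rewrite maxn0 ug.
  by case: (plgfs_held a g m) uh => [k|] ->; [apply/maxn_idPr|rewrite maxn0].
suff h m : [/\ latest_received (plgfs_delivered a g) m.+1 <= last 0 (packets m),
      g m -> latest_received (plgfs_delivered a g) m.+1 = last 0 (packets m) &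
      if plgfs_held a g m is Some k then k = last 0 (packets m)
      else latest_received (plgfs_delivered a g) m.+1 = last 0 (packets m)].
  by split; [apply: h|apply/next/h].
elim: m => [|m IH]; first by rewrite latest_received1.
rewrite (next _ IH); case: IH => ule ug uh.
have [_ lm] := packets_sorted m.
have mono : last 0 (packets m) <= last 0 (packets m.+1).
  by rewrite /=; case: (a m.+1); rewrite ?last_rcons // leqW.
split.
- by case: (g m.+1) => //; apply: leq_trans mono.
- by move=> ->.
rewrite /=; case: (a m.+1); first by rewrite last_rcons.
case: (g m) ug => ug; first by rewrite ug // if_same.
by case: (plgfs_held a g m) uh => [k|] ->; rewrite ?if_same.
Qed.

Lemma plgfs_latest_receivedS n : latest_received (plgfs_delivered a g) n.+2 =
  if g n.+1 then last 0 (packets n.+1) else latest_received (plgfs_delivered a g) n.+1.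
Proof. by have [] := plgfs_invariant n. Qed.

Lemma plgfs_posE n :
  plgfs_pos (history n) + latest_received (plgfs_delivered a g) n.+1 = n.
Proof.
elim: n => [|n IH]; first by rewrite latest_received1.
rewrite plgfs_latest_receivedS [history _]/= /plgfs_pos -/plgfs_pos /=.
by case: (g n.+1); [exact: (last_packetE n.+1)|rewrite addSn IH].
Qed.

Lemma size_packets_mono m n : m <= n -> size (packets m) <= size (packets n).
Proof.
move=> mn; rewrite -(subnK mn); elim: (n - m) => [|k IH] //=.
by case: (a _); rewrite // size_rcons leqW.
Qed.

Lemma count_packets t : \sum_(1 <= s < t.+1) a s = size (packets t).
Proof.
elim: t => [|t IH]; first by rewrite big_geq.
by rewrite big_nat_recr //= IH; case: (a t.+1); rewrite ?size_rcons ?addn1 ?addn0.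
Qed.

Lemma nth_packets n i : 0 < i <= size (packets n) ->
  let t := nth 0 (0 :: packets n) i in
  [/\ 0 < t <= n, a t & size (packets t) = i].
Proof.
elim: n => [|n IH] /=; first by case: i.
case an: (a n.+1); last first.
  by move=> /IH[/andP[t0 tn] ? ?]; split=> //; rewrite t0 leqW.
rewrite size_rcons => /andP[i0]; rewrite leq_eqVlt ltnS => /orP[/eqP ->|iN].
  by rewrite /= nth_rcons ltnn eqxx /= an size_rcons ltnSn.
have -> : nth 0 (0 :: rcons (packets n) n.+1) i = nth 0 (0 :: packets n) i.
  by case: i i0 iN {IH} => //= i _ iN; rewrite nth_rcons iN.
by have [|/andP[t0 tn] ? ?] := IH; [rewrite i0|split=> //; rewrite t0 leqW].
Qed.

Lemma packet_index_inj t t' : 0 < t -> 0 < t' -> a t -> a t' ->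
  size (packets t) = size (packets t') -> t = t'.
Proof.
wlog tt' : t t' / t <= t'.
  move=> W t0 t'0 at0 at' e; have [tt'|/ltnW tt'] := leqP t t'; first exact: W.
  by apply/esym/W.
case: t' tt' => // t' tt' t0 _ _ at' e; apply/eqP; move: tt'.
rewrite leq_eqVlt => /orP[//|]; rewrite ltnS => /size_packets_mono.
by rewrite e /= at' size_rcons ltnn.
Qed.

Lemma gen_slotE n i : 0 < i <= size (packets n) ->
  gen_slot a i = nth 0 (0 :: packets n) i.
Proof.
move=> hi; have [/andP[t0 tn] at0 e] := nth_packets hi.
apply: xget_unique => [|t [s0 as0]]; first by split=> //; rewrite count_packets.
by rewrite count_packets => es; apply: packet_index_inj => //; rewrite e es.
Qed.

Local Notation nserved n := (size (served n)).

Lemma nserved_mono m n : m <= n -> nserved m <= nserved n.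
Proof.
move=> mn; rewrite -(subnK mn); elim: (n - m) => [|k IH] //=.
by case: fcfs_delivered => [j|] //; rewrite size_rcons leqW.
Qed.

Lemma nserved_packets n : nserved n <= size (packets n).
Proof. by rewrite packets_served size_cat leq_addr. Qed.

Lemma gen_slot_served n i : 0 < i <= nserved n -> gen_slot a i = nth 0 (0 :: served n) i.
Proof.
case/andP=> i0 iN; rewrite (@gen_slotE n) ?i0 ?(leq_trans iN (nserved_packets n)) //.
by rewrite packets_served -cat_cons nth_cat ltnS /= iN.
Qed.

Lemma fcfs_delivered_some s k : fcfs_delivered a g s.+1 = Some k ->
  [/\ nserved s.+1 = (nserved s).+1, gen_slot a (nserved s.+1) = k & g s.+1].
Proof.
move=> e; have ns : nserved s.+1 = (nserved s).+1 by rewrite /= e size_rcons.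
split=> //; last by move: e; rewrite /fcfs_delivered; case: (g s.+1).
rewrite (@gen_slot_served s.+1) ?ns ?leqnn // -ns nth_last0 /= e.
by rewrite last_rcons.
Qed.

Lemma gen_slot_inj n i j : 0 < i <= nserved n -> 0 < j <= nserved n ->
  gen_slot a i = gen_slot a j -> i = j.
Proof.
have up k : 0 < k <= nserved n -> 0 < k <= size (packets n).
  by case/andP=> -> /leq_trans; apply; apply: nserved_packets.
move=> /up hi /up hj; rewrite (gen_slotE hi) (gen_slotE hj) => e.
by have [_ _ <-] := nth_packets hi; have [_ _ <-] := nth_packets hj; rewrite e.
Qed.

(* Off by one from [recv_slot]: the slot in which packet i is transmitted. *)
Definition serv_slot i := (recv_slot a g i).-1.

Lemma recv_slotE i : recv_slot a g i = (serv_slot i).+1.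
Proof. by []. Qed.

Lemma serv_slotP n i : 0 < i <= nserved n ->
  exists s, [/\ serv_slot i = s.+1, s < n, nserved s.+1 = i,
                nserved s = i.-1 & fcfs_delivered a g s.+1 = Some (gen_slot a i)].
Proof.
case/andP=> i0 iN.
have [s sn [es es1]] : exists2 s, s < n & nserved s.+1 = i /\ nserved s = i.-1.
  elim: n iN => [|n IH]; first by rewrite leqNgt i0.
  have [iN _|Ni iS] := leqP i (nserved n).
    by have [s sn h] := IH iN; exists s => //; apply: leqW.
  exists n => //; move: iS Ni; rewrite /=.
  by case: fcfs_delivered => [k|]; rewrite ?size_rcons; lia.
have ds : fcfs_delivered a g s.+1 = Some (gen_slot a i).
  case e: (fcfs_delivered a g s.+1) => [k|]; last by move: es; rewrite /= e es1; lia.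
  by have [_ <- _] := fcfs_delivered_some e; rewrite es.
exists s; split=> //; rewrite /serv_slot /recv_slot /=.
apply: xget_unique => // -[|s'] /= e; first by move: e; rewrite /fcfs_delivered /=; case: (g 0).
have [ns' gs' _] := fcfs_delivered_some e.
have s'i : nserved s'.+1 = i.
  apply: (@gen_slot_inj (maxn s.+1 s'.+1)) => //.
    by apply/andP; split; [rewrite ns'|apply/nserved_mono/leq_maxr].
  by rewrite i0 -es; apply/nserved_mono/leq_maxl.
have [ss'|s's|->//] := ltngtP s s'.
  by have := nserved_mono ss'; lia.
by have := nserved_mono s's; lia.
Qed.

(** Galois connection between transmission slots and delivery counts; it turns ranges of slots into
    statements on the number of served packets. *)
Lemma serv_slot_le n i t : 0 < i <= nserved n -> (serv_slot i <= t) = (i <= nserved t).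
Proof.
move=> hi; have i0 : 0 < i by case/andP: hi.
have [s [-> _ es es1 _]] := serv_slotP hi; apply/idP/idP.
  by move=> /nserved_mono; rewrite es.
by move=> it; rewrite ltnNge; apply/negP => /nserved_mono; lia.
Qed.

(** pLGFS gains news only in slots where FCFS delivers. A good slot without FCFS delivery means an
    empty queue, so FCFS already has the newest packet, and pLGFS is never behind FCFS. *)
Lemma plgfs_latest_received_idle n : nserved n.+1 = nserved n ->
  latest_received (plgfs_delivered a g) n.+2 = latest_received (plgfs_delivered a g) n.+1.
Proof.
rewrite plgfs_latest_receivedS; case gn: (g n.+1) => //=.
rewrite /fcfs_delivered gn; case e: (fcfs_queue a g n.+1) => [|k q] /=.
  move=> _; have [e1 e2] := served_queue n.
  have an : a n.+1 = false.
    by move: e; rewrite fcfs_queueS; case: (a n.+1) => //; case: carried.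
  have c0 : carried n = [::] by move: e; rewrite fcfs_queueS an.
  rewrite an; apply/eqP; rewrite eqn_leq; apply/andP; split.
    have := plgfs_posE n; have := fcfs_posE n; have := plgfs_le_fcfs_pos (history n).
    by rewrite fcfs_latest_received e2 c0 cats0; lia.
  by have [[]] := plgfs_invariant n.
by rewrite size_rcons => /eqP; rewrite gtn_eqF.
Qed.

Lemma plgfs_latest_received_const m n : m <= n -> nserved m = nserved n ->
  latest_received (plgfs_delivered a g) n.+1 = latest_received (plgfs_delivered a g) m.+1.
Proof.
move=> mn; rewrite -(subnK mn); elim: (n - m) => [|k IH] // e.
have h1 := nserved_mono (leq_addl k m); have h2 := nserved_mono (leqnSn (k + m)).
rewrite addSn plgfs_latest_received_idle; last by move: e; rewrite addSn; lia.
by apply: IH; move: e; rewrite addSn; lia.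
Qed.

Lemma last_gen_slotE n i : 0 < i <= nserved n ->
  last_gen_slot a g i = last 0 (packets (serv_slot i)).
Proof.
move=> hi; have [s [es sn e1 e2 ds]] := serv_slotP hi.
rewrite /last_gen_slot recv_slotE es.
have i0 : 0 < i by case/andP: hi.
have hi' : 0 < i <= size (packets s.+1).
  by rewrite i0 -e1 nserved_packets.
have gi := gen_slotE hi'; have [/andP[t0 ts] at0 _] := nth_packets hi'.
rewrite -gi in t0 ts at0.
have le_last t : 0 < t -> t <= s.+1 -> a t -> t <= last 0 (packets s.+1).
  move=> {}t0; elim: (s.+1) => [|m IH] /=; first by rewrite leqNgt t0.
  case am: (a m.+1); first by rewrite last_rcons.
  rewrite leq_eqVlt => /orP[/eqP ->|/ltnSE tm]; [by rewrite am|exact: IH].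
apply/eqP; rewrite eqn_leq; apply/andP; split.
  apply/bigmax_leqP_seq => t; rewrite mem_index_iota => /andP[gt ts'] at1.
  by apply: le_last => //; apply: leq_trans gt.
have := @nth_packets s.+1 (size (packets s.+1)); rewrite leqnn nth_last0.
case: (size (packets s.+1)) hi' => [|k] hi'; first by lia.
move=> /(_ isT)[/andP[l0 ls] al _].
apply: (@leq_bigmax_seq _ _ _ (fun s => s)) => //.
by rewrite mem_index_iota ltnS ls andbT le_last.
Qed.

End Path.

Section Identity.
Variables (R : realType) (a g : nat -> bool).
Local Notation nserved n := (size (served a g n)).

(** Packet i is sent in a good slot, at which pLGFS receives the packet generated at t_w. Up to the
    next FCFS delivery both latest packets stay fixed, so the difference is Y_i throughout D_i
    slots. Before the first delivery both are 0. *)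
Lemma sum_AoI_difference n N : (n < nserved N)%N ->
  \sum_(1 <= t < (serv_slot a g n.+1).+1)
     (AoI R (fcfs_delivered a g) t - AoI R (plgfs_delivered a g) t) =
  \sum_(1 <= i < n.+1) inter_delivery R a g i * preemption_time R a g i.
Proof.
pose f m : R := (latest_received (plgfs_delivered a g) m.+1)%:R -
  (latest_received (fcfs_delivered a g) m.+1)%:R.
move=> nN; rewrite big_add1 /=.
transitivity (\sum_(0 <= m < serv_slot a g n.+1) f m).
  by apply: eq_bigr => m _; rewrite /AoI /f; ring.
elim: n nN => [|n IH] nN.
  rewrite [RHS]big_geq // big_nat big1 // => m /andP[_ m1].
  have n0 : nserved m = 0%N.
    by apply/eqP; rewrite -leqn0 leqNgt -(@serv_slot_le a g N) ?nN // -ltnNge.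
  rewrite /f (plgfs_latest_received_const (leq0n m)) // latest_received1.
  by rewrite fcfs_latest_received (size0nil n0) subrr.
have hi : (0 < n.+1 <= nserved N)%N by rewrite /= ltnW.
have hi2 : (0 < n.+2 <= nserved N)%N by [].
have [s [es sN e1 e2 ds]] := serv_slotP hi.
have [s' [es' sN' e1' e2' ds']] := serv_slotP hi2.
have ss' : (serv_slot a g n.+1 <= serv_slot a g n.+2)%N.
  by rewrite (serv_slot_le _ hi) es' e1'.
rewrite (big_cat_nat _ ss') //= IH; last exact: ltnW.
rewrite [RHS]big_nat_recr //=; congr (_ + _).
rewrite (eq_big_nat _ _ (F2 := fun=> preemption_time R a g n.+1)); last first.
  move=> m /andP[sm ms'].
  have nm : nserved m = n.+1.
    apply/eqP; rewrite eqn_leq -(serv_slot_le _ hi) sm andbT.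
    by rewrite leqNgt -(serv_slot_le _ hi2) -ltnNge.
  rewrite /f /preemption_time (last_gen_slotE hi); congr (_%:R - _%:R).
    rewrite (@plgfs_latest_received_const _ _ (serv_slot a g n.+1)) //; last by rewrite es e1.
    rewrite es plgfs_latest_receivedS.
    by have [_ _ ->] := fcfs_delivered_some ds.
  by rewrite fcfs_latest_received (@gen_slot_served a g m) ?nm ?leqnn // -nm nth_last0.
rewrite sumr_const_nat /inter_delivery !recv_slotE -[_ *+ (_ - _)%N]mulr_natl natrB //.
by rewrite -!natr1; ring.
Qed.

End Identity.

(** * Almost sure limits *)

Section PathLimits.
Variables (R : realType) (a g : nat -> bool).
Local Notation history n := (hist (fun t => (a t, g t)) n).
Local Notation nserved n := (size (served a g n)).

Lemma AoI_fcfs n : AoI R (fcfs_delivered a g) n.+1 = (fcfs_pos (history n)).+1%:R.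
Proof.
by apply/eqP; rewrite /AoI subr_eq -natrD addSn fcfs_posE.
Qed.

Lemma AoI_plgfs n : AoI R (plgfs_delivered a g) n.+1 = (plgfs_pos (history n)).+1%:R.
Proof.
by apply/eqP; rewrite /AoI subr_eq -natrD addSn plgfs_posE.
Qed.

Lemma average_AoI_sums (X : seq slot -> nat) delivered (c : R) :
  (forall n, AoI R delivered n.+1 = (X (history n)).+1%:R) ->
  sums (fun h => (X h).+1%:R : R) (history n) / n.+1%:R @[n --> \oo] --> c ->
  average_AoI R delivered tau @[tau --> \oo] --> c.
Proof.
move=> AX sc; rewrite -cvg_shiftS; apply: cvg_trans sc; apply: near_eq_cvg.
apply: nearW => n /=; rewrite /average_AoI sums_hist mulrC big_add1 /= big_mkord.
by congr (_ * _); apply: eq_bigr => i _; rewrite AX.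
Qed.

Lemma average_last_term (u : nat -> R) (c : R) :
  n%:R^-1 * (\sum_(1 <= t < n.+1) u t) @[n --> \oo] --> c ->
  u n.+1 / n.+1%:R @[n --> \oo] --> 0.
Proof.
set s := (fun n => _) => sc.
have sc1 : s n.+1 @[n --> \oo] --> c by rewrite cvg_shiftS.
have : s n.+1 - s n * (1 - n.+1%:R^-1) @[n --> \oo] --> c - c * (1 - 0).
  apply: cvgB => //; apply: cvgM => //; apply: cvgB; first exact: cvg_cst.
  exact: cvg_harmonic.
rewrite subr0 mulr1 subrr; apply: cvg_trans; apply: near_eq_cvg; apply: nearW => n.
rewrite /s big_nat_recr //=; set w := \sum_(1 <= t < n.+1) _.
case: n @w => [|n] w; first by rewrite /w big_geq // invr1 !mulr1 subrr mulr0 subr0 mul1r add0r.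
have m0 : 0 < n.+1%:R :> R by rewrite ltr0n.
rewrite -[n.+2%:R]natr1; move: n.+1%:R (u _) w m0 => m x w m0.
by field; rewrite !lt0r_neq0 // addr_gt0.
Qed.

(** Since the backlog is o(n), deliveries also occur at rate lambda, so packet n is sent at about n
    / lambda. Evaluating the average ages at these times turns a slot average into a packet
    average. *)
Lemma average_DY_limit (lambda cF cL : R) : 0 < lambda ->
  average_AoI R (fcfs_delivered a g) tau @[tau --> \oo] --> cF ->
  average_AoI R (plgfs_delivered a g) tau @[tau --> \oo] --> cL ->
  (size (packets a n))%:R / n.+1%:R @[n --> \oo] --> lambda ->
  average_DY R a g n @[n --> \oo] --> (cF - cL) / lambda.
Proof.
move=> l0 hF hL hA.
have hage := average_last_term hF.
have hQ : (backlog (history n))%:R / n.+1%:R @[n --> \oo] --> (0 : R).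
  apply: squeeze_cvgr hage; last exact: cvg_cst; apply: nearW => n.
  rewrite divr_ge0 //= AoI_fcfs ler_pM2r ?invr_gt0 ?ltr0n // ler_nat leqW //.
  by rewrite arrivals_le_arrival_pos // backlog_arrivals.
have hN : (nserved n)%:R / n.+1%:R @[n --> \oo] --> lambda.
  have : (size (packets a n))%:R / n.+1%:R - (backlog (history n))%:R / n.+1%:R
    @[n --> \oo] --> lambda - 0 by apply: cvgB.
  rewrite subr0; apply: cvg_trans; apply: near_eq_cvg; apply: nearW => n.
  by rewrite -mulrBl -(size_served a g) natrD addrK.
(* A positive delivery rate means that every packet is eventually served, so [serv_slot] never takes
   its default value. *)
have served_all n : exists N, (n < nserved N)%N.
  have l20 : 0 < lambda / 2 by rewrite divr_gt0.
  have [M _ hM] := (cvgrPdist_le _ _).1 hN _ l20.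
  pose N := maxn M (Num.trunc (n%:R / (lambda / 2))).+1; exists N.
  have := hM N (leq_maxl _ _); rewrite ler_distlC => /andP[+ _].
  rewrite (_ : lambda - lambda / 2 = lambda / 2); last by field.
  rewrite ler_pdivlMr ?ltr0n // => h; rewrite -(ltr_nat R); apply: lt_le_trans h.
  rewrite mulrC -ltr_pdivrMr //; apply: (lt_trans (truncnS_gt _)).
  by rewrite ltr_nat ltnS leq_maxr.
pose tau n := serv_slot a g n.+1.
have tauP n : nserved (tau n) = n.+1.
  have [N nN] := served_all n.
  by have [|s [es _ e _ _]] := @serv_slotP a g N n.+1; rewrite ?nN // /tau es.
have tau_ge n : (n < tau n)%N.
  rewrite -tauP; apply: leq_trans (nserved_packets _ _ _) _.
  by rewrite (size_packets a g) (leq_trans (arrivals_size _)) // size_hist.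
have tauoo : tau n @[n --> \oo] --> \oo.
  by apply/cvgnyPge => A; exists A => // n /= An; apply: leq_trans An (ltnW (tau_ge n)).
have taul : n.+1%:R / (tau n).+1%:R @[n --> \oo] --> lambda.
  have := cvg_comp _ _ tauoo hN; apply: cvg_trans; apply: near_eq_cvg.
  by apply: nearW => n /=; rewrite tauP.
have hD : average_AoI R (fcfs_delivered a g) (tau n) -
    average_AoI R (plgfs_delivered a g) (tau n) @[n --> \oo] --> cF - cL.
  by apply: cvgB; [exact: (cvg_comp _ _ tauoo hF)|exact: (cvg_comp _ _ tauoo hL)].
have hratio : (tau n.+1)%:R / n.+1%:R @[n --> \oo] --> lambda^-1.
  have hinv : (tau n.+1).+1%:R / n.+2%:R @[n --> \oo] --> lambda^-1.
    rewrite (cvg_shiftS (fun n => (tau n).+1%:R / n.+1%:R : R)).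
    have h : (n.+1%:R / (tau n).+1%:R)^-1 @[n --> \oo] --> lambda^-1.
      exact: cvgV (lt0r_neq0 l0) taul.
    apply: cvg_trans h.
    by apply: near_eq_cvg; apply: nearW => n /=; rewrite invf_div.
  have : (tau n.+1).+1%:R / n.+2%:R * (1 + n.+1%:R^-1) - n.+1%:R^-1 @[n --> \oo] -->
      lambda^-1 * (1 + 0) - 0.
    apply: cvgB; last exact: cvg_harmonic.
    apply: cvgM => //; apply: cvgD; first exact: cvg_cst.
    exact: cvg_harmonic.
  rewrite addr0 mulr1 subr0; apply: cvg_trans; apply: near_eq_cvg; apply: nearW => n /=.
  have m0 : 0 < n.+1%:R :> R by rewrite ltr0n.
  rewrite -[(tau n.+1).+1%:R]natr1 -[n.+2%:R]natr1; move: n.+1%:R (tau n.+1)%:R m0 => m x m0.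
  by field; rewrite !lt0r_neq0 // addr_gt0.
rewrite -cvg_shiftS.
have hD1 : average_AoI R (fcfs_delivered a g) (tau n.+1) -
    average_AoI R (plgfs_delivered a g) (tau n.+1) @[n --> \oo] --> cF - cL.
  by rewrite (cvg_shiftS (fun n => average_AoI R (fcfs_delivered a g) (tau n) -
    average_AoI R (plgfs_delivered a g) (tau n))).
have hM : (tau n.+1)%:R / n.+1%:R * (average_AoI R (fcfs_delivered a g) (tau n.+1) -
    average_AoI R (plgfs_delivered a g) (tau n.+1)) @[n --> \oo] --> lambda^-1 * (cF - cL).
  exact: cvgM.
rewrite mulrC; apply: cvg_trans hM; apply: near_eq_cvg; apply: nearW => n /=.
have [N nN] := served_all n.+1.
rewrite /average_DY -(sum_AoI_difference R nN) sumrB -/(tau n.+1) /average_AoI -mulrBr.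
have t0 : (tau n.+1)%:R != 0 :> R.
  by rewrite pnatr_eq0 -lt0n; apply: leq_ltn_trans (tau_ge _).
rewrite mulrA; congr (_ * _).
by rewrite mulrAC divff // mul1r.
Qed.

End PathLimits.

Section AlmostSure.
Context d (T : measurableType d) (R : realType) (P : probability T R).
Variables (arr chan : nat -> {RV P >-> bool}) (p r lambda : R).
Hypothesis hp : 0 < p < 1.
Hypothesis hr : 0 < r < 1.
Hypothesis hlambda : 0 < lambda < r / (p + r).
Hypothesis harr : bernoulli_arrivals arr lambda.
Hypothesis hchan : GE_channel chan p r.
Hypothesis hindep : independent_processes arr chan.

Let mu := initial_law chan.
Let kernel := slot_kernel p r lambda mu.
Let kernel_ge0 := slot_kernel_ge0 hp hr hlambda (initial_law_ge0 chan).
Let kernel_sum := slot_kernel_sum p r lambda (initial_law_sum chan).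
Local Notation history w n := (hist (fun t => (arr t w, chan t w)) n).

Lemma memory_law (X : seq slot -> R) (L : seq slot -> nat) (C : R) :
  (forall h, 0 <= X h) -> (forall h, X h <= (size h).+1%:R) ->
  (forall h, (0 < L h)%N) ->
  (forall h M, (L h <= M)%N -> X (take M h) = X h) ->
  (forall t, expect kernel t (fun h => (L h)%:R ^+ 4) [::] <= C) ->
  exists2 c : R, expect kernel n X [::] @[n --> \oo] --> c &
    {ae P, forall w, sums X (history w n) / n.+1%:R @[n --> \oo] --> c}.
Proof.
have [delta delta01 kd] := slot_kernel_doeblin mu hp hr hlambda.
apply: (finite_memory_law kernel_ge0 kernel_sum (@slot_kernel_markov _ p r lambda mu)
  delta01 kd (slots_measurable arr chan) (slots_law harr hchan hindep)).
Qed.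

Lemma packets_law : {ae P, forall w,
  (size (packets (fun t => arr t w) n))%:R / n.+1%:R @[n --> \oo] --> lambda}.
Proof.
pose X (h : seq slot) : R := (head (false, false) h).1%:R.
have [||||t|c ec hc] := @memory_law X (fun=> 1%N) 1.
- by move=> h.
- by move=> h; rewrite ler_nat; case: (head _ _).1.
- by [].
- by move=> [|y h] [|M].
- by rewrite expr1n expect_cst.
(* The expected arrival indicator equals lambda from slot 1 on, which identifies the limit. *)
have -> : lambda = c.
  have : expect kernel n.+1 X [::] @[n --> \oo] --> c.
    by rewrite (cvg_shiftS (fun n => expect kernel n X [::])).
  apply: (cvg_unique (@norm_hausdorff _ R)); apply: cvg_near_cst; apply: nearW => n.
  rewrite expectSr (@eq_expect _ _ kernel n _ (fun=> lambda)) ?expect_cst // => h.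
  rewrite /step sum_slot /X /= !mulr1 !mulr0 !addr0.
  have := kernel_sum h; rewrite sum_slot /kernel /slot_kernel /=.
  set u := (if h is _ :: _ then _ else _); set v := (if h is _ :: _ then _ else _).
  by rewrite -!mulrDr -mulrDl /= subrKC mul1r => ->; rewrite mulr1.
apply: filterS hc => w; apply: cvg_trans; apply: near_eq_cvg; apply: nearW => n.
congr (_ / _); rewrite sums_hist big_ord_recl add0r.
elim: n => [|n IH]; first by rewrite big_ord0.
rewrite big_ord_recr /= IH /X /=; case: (arr _ w); last by rewrite addr0.
by rewrite size_rcons -natr1.
Qed.

Lemma AoI_law (pos : seq slot -> nat) :
  (forall h, (pos h <= size h)%N) ->
  (forall K h M, (0 < K)%N -> (memory K h <= M)%N -> pos (take M h) = pos h) ->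
  exists c : R, {ae P, forall w,
    sums (fun h => (pos h).+1%:R) (history w n) / n.+1%:R @[n --> \oo] --> c}.
Proof.
move=> ps ptk.
have [K K0 [C hC]] := memory_moment hp hr hlambda (initial_law_ge0 chan) (initial_law_sum chan).
have [||||//|c _ hc] := @memory_law (fun h => (pos h).+1%:R) (memory K) C; last by exists c.
- by [].
- by move=> h; rewrite ler_nat ltnS.
- by [].
- by move=> h M hM /=; rewrite (ptk K).
Qed.

End AlmostSure.

Unset Implicit Arguments.

Theorem mainTheorem6 (d : measure_display) (T : measurableType d)
  (R : realType) (P : probability T R)
  (arr chan : nat -> {RV P >-> bool}) (p r lambda : R)
  (hp : 0 < p < 1) (hr : 0 < r < 1) (hlambda : 0 < lambda < r / (p + r))
  (harr : bernoulli_arrivals arr lambda)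
  (hchan : GE_channel chan p r)
  (hindep : independent_processes arr chan) :
  exists DeltaF DeltaL EDY : R,
    [/\ {ae P, forall w, average_AoI R
           (fcfs_delivered (fun t => arr t w) (fun t => chan t w)) tau
             @[tau --> \oo] --> DeltaF},
        {ae P, forall w, average_AoI R
           (plgfs_delivered (fun t => arr t w) (fun t => chan t w)) tau
             @[tau --> \oo] --> DeltaL},
        {ae P, forall w, average_DY R
           (fun t => arr t w) (fun t => chan t w) n @[n --> \oo] --> EDY}
      & DeltaF = DeltaL + lambda * EDY].
Proof.
have [cF hF] := AoI_law hp hr hlambda harr hchan hindep
  (fun h => arrival_pos_size (backlog h) h) fcfs_pos_take.
have [cL hL] := AoI_law hp hr hlambda harr hchan hindep
  plgfs_pos_size (fun K h M _ => @plgfs_pos_take_memory K h M).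
have hA := packets_law hp hr hlambda harr hchan hindep.
have l0 : 0 < lambda by case/andP: hlambda.
have aF : {ae P, forall w, average_AoI R
    (fcfs_delivered (fun t => arr t w) (fun t => chan t w)) tau @[tau --> \oo] --> cF}.
  by apply: filterS hF => w; apply: average_AoI_sums => n; apply: AoI_fcfs.
have aL : {ae P, forall w, average_AoI R
    (plgfs_delivered (fun t => arr t w) (fun t => chan t w)) tau @[tau --> \oo] --> cL}.
  by apply: filterS hL => w; apply: average_AoI_sums => n; apply: AoI_plgfs.
exists cF, cL, ((cF - cL) / lambda); split=> //.
  by apply: filterS3 aF aL hA => w; apply: average_DY_limit.
by rewrite mulrC divfK ?lt0r_neq0 // addrC subrK.
Qed.
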